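(* Let $\mathcal{T}$ and $\widetilde{\mathcal{T}}$ be compact nonnegative self-adjoint operators in Hilbert spaces $\mathcal{H}$ and $\widetilde{\mathcal{H}}$, with eigenvalues $\lambda_n$ and $\widetilde\lambda_n$, having the spectral asymptotics $$\mathcal{N}(t,\mathcal{T})\sim\frac{\varphi(1/t)\,s(\ln(1/t))}{t^{1/p}},\qquad \mathcal{N}(t,\widetilde{\mathcal{T}})\sim\frac{\widetilde\varphi(1/t)\,\widetilde s(\ln(1/t))}{t^{1/p}},\qquad t\to+0,$$ where $p>0$, $\varphi,\widetilde\varphi$ are slowly varying functions, and $s,\widetilde s$ are continuous periodic functions with periods $T$ and $\widetilde T$, respectively. Suppose that $$\int_1^\infty\varphi(\tau)\frac{d\tau}{\tau}<\infty,\qquad \int_1^\infty\widetilde\varphi(\tau)\frac{d\tau}{\tau}<\infty,$$ and that $$\int_1^\infty\varphi(\sigma)\,m_{\widetilde\varphi}(\sigma)\frac{d\sigma}{\sigma}<\infty,\qquad \int_1^\infty\widetilde\varphi(\sigma)\,m_{\varphi}(\sigma)\frac{d\sigma}{\sigma}<\infty,\qquad\text{where } m_\psi(\sigma)=\sup_{\tau>\sigma^2}\frac{\psi(\tau/\sigma)}{\psi(\tau)}.$$ Then, as $t\to+0$, $$\mathcal{N}(t,\mathcal{T}\otimes\widetilde{\mathcal{T}})\sim\frac{\varphi(1/t)\,s^*(\ln(1/t))+\widetilde\varphi(1/t)\,\widetilde s^*(\ln(1/t))}{t^{1/p}},$$ where $$s^*(\tau)=\sum_k s(\tau+\ln\widetilde\lambda_k)\,\widetilde\lambda_k^{1/p},\qquad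 \widetilde s^*(\tau)=\sum_n\widetilde s(\tau+\ln\lambda_n)\,\lambda_n^{1/p}.$$
   Context: For a compact nonnegative self-adjoint operator $\mathcal{T}$ in a Hilbert space, $\lambda_n=\lambda_n(\mathcal{T})$ denote its positive eigenvalues arranged in nonincreasing order and repeated according to multiplicity, and $\mathcal{N}(t,\mathcal{T})=\#\{n:\lambda_n(\mathcal{T})>t\}$ for $t>0$. Similarly $\widetilde\lambda_k$ are the positive eigenvalues of $\widetilde{\mathcal{T}}$. The operator $\mathcal{T}\otimes\widetilde{\mathcal{T}}$ acts in the Hilbert space $\mathcal{H}\otimes\widetilde{\mathcal{H}}$. The relation $f\sim g$ means $f=g\,(1+o(1))$. A positive (measurable) function $\varphi(\tau)$, $\tau>0$, is called slowly varying if $\varphi(c\tau)/\varphi(\tau)\to1$ as $\tau\to+\infty$ for every constant $c>0$. Standing assumptions: slowly varying functions in the spectral asymptotics are $C^2$-smooth with $\tau(\ln\varphi)'(\tau)\to0$ and $\tau^2(\ln\varphi)''(\tau)\to0$ as $\tau\to\infty$; the periodic functions $s,\widetilde s$ are continuous, positive (bounded and separated from zero), and $s(\tau)=e^{-\tau/p}\varrho(\tau)$, $\widetilde s(\tau)=e^{-\tau/p}\widetilde\varrho(\tau)$ with $\varrho,\widetilde\varrho$ monotone. *)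

(* Defs.v *)
From HB Require Import structures.
From mathcomp Require Import all_boot all_order all_algebra.
From mathcomp Require Import complex finmap.
From mathcomp Require Import all_classical all_reals all_analysis.

Set Implicit Arguments.
Unset Strict Implicit.
Unset Printing Implicit Defensive.

Import Order.TTheory GRing.Theory Num.Theory.
Import numFieldNormedType.Exports.

Local Open Scope classical_set_scope.
Local Open Scope ring_scope.

(* [ofR] embeds the reals into the scalar field and [conj] is its conjugation. *)
Variant scalar_field (R : realType) :
    forall K : numFieldType, (R -> K) -> (K -> K) -> Prop :=
  | RealScalars : @scalar_field R R idfun idfun
  | ComplexScalars : @scalar_field R R[i] (real_complex R) Num.conj.

Record hilbertSpace (K : numFieldType) (conj : K -> K) := HilbertSpace {
  hilbert_sort :> completeNormedModType K ;
  hdot : {dot hilbert_sort for conj} ;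
  hnormE : forall x, `|x| ^+ 2 = hdot x x }.

Notation "''[' x , y ]" := (hdot _ x y)
  (at level 0, format "''[' x ,  y ]") : ring_scope.

Section Operators.
Context {R : realType} {K : numFieldType} (ofR : R -> K) {conj : K -> K}.
Context {H : hilbertSpace conj}.
Implicit Types (T : H -> H) (E : set H) (lam : R^nat).

Definition compact_operator T :=
  precompact [set T x | x in [set x : H | `|x| <= 1]].

Definition selfadjoint T := forall x y : H, '[T x, y] = '[x, T y].

Definition nonnegative_operator T := forall x : H, 0 <= '[T x, x].

Definition eigenvectors T (mu : R) : set H := [set x | T x = ofR mu *: x].

Definition has_dim E (n : nat) := exists e : 'I_n -> H,
  (forall a : 'I_n -> K, \sum_i a i *: e i = 0 -> forall i, a i = 0) /\
  E = [set \sum_i a i *: e i | a in [set: 'I_n -> K]].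

(* If [T] has only finitely many positive eigenvalues, [lam] is their list
   followed by zeros. *)
Definition eigenvalue_sequence T lam :=
  [/\ nonincreasing_seq lam, forall n, 0 <= lam n &
      forall mu : R, 0 < mu -> exists m : nat,
        ([set n | lam n = mu] #= `I_m)%card /\ has_dim (eigenvectors T mu) m].

(* A compact nonnegative self-adjoint operator has exactly one such sequence. *)
Definition eigenvalues T : R^nat := xget (fun=> 0) (eigenvalue_sequence T).

Definition counting_function (t : R) T : R :=
  #|` fset_set [set n | t < eigenvalues T n]|%:R.

End Operators.

Section TensorProduct.
Context {K : numFieldType} {conj : K -> K}.
Context {H H' HH : hilbertSpace conj}.

(* [HH] with the map [tens] is a Hilbert tensor product of [H] and [H']; it is
   determined up to a unitary isomorphism compatible with [tens]. *)
Definition hilbert_tensor (tens : {bilinear H -> H' -> HH}) :=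
  (forall x x' y y', '[tens x y, tens x' y'] = '[x, x'] * '[y, y']) /\
  closure [set v : HH | exists (n : nat) (x : 'I_n -> H) (y : 'I_n -> H'),
    v = \sum_i tens (x i) (y i)] = setT.

Definition tensor_operator (tens : {bilinear H -> H' -> HH})
    (T : H -> H) (T' : H' -> H') (TT : HH -> HH) :=
  continuous TT /\ forall x y, TT (tens x y) = tens (T x) (T' y).

End TensorProduct.

Section Asymptotics.
Context {R : realType}.
Implicit Types (phi psi s lam : R -> R).

Definition slowly_varying phi :=
  [/\ forall tau : R, 0 < tau -> 0 < phi tau,
      measurable_fun (`]0, +oo[%classic : set R) phi &
      forall c : R, 0 < c -> phi (c * tau) / phi tau @[tau --> +oo_R] --> (1 : R)].

Definition C2_smooth phi := forall tau : R, 0 < tau ->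
  [/\ derivable phi tau 1, derivable (derive1 phi) tau 1 &
      {for tau, continuous (derive1n 2 phi)}].

Definition regular_slowly_varying phi :=
  [/\ slowly_varying phi, C2_smooth phi,
      tau * derive1 (fun x => ln (phi x)) tau @[tau --> +oo_R] --> (0 : R) &
      tau ^+ 2 * derive1n 2 (fun x => ln (phi x)) tau @[tau --> +oo_R] --> (0 : R)].

Definition regular_periodic (p T : R) s :=
  [/\ 0 < T /\ forall tau : R, s (tau + T) = s tau,
      continuous s,
      exists a b, 0 < a /\ forall tau : R, a <= s tau <= b &
      exists2 rho : R -> R, nondecreasing_fun rho \/ nonincreasing_fun rho &
         forall tau : R, s tau = expR (- tau / p) * rho tau].

Definition ratio_sup psi (sigma : R) : \bar R :=
  ereal_sup [set (psi (tau / sigma) / psi tau)%:E |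
             tau in [set tau | sigma ^+ 2 < tau]].

(* The condition drops the zeros that pad a finite list of eigenvalues. *)
Definition periodic_transform (p : R) s (lam : R^nat) (tau : R) : R :=
  \big[+%R/0]_(0 <= k <oo | 0 < lam k) (s (tau + ln (lam k)) * lam k `^ p^-1).

End Asymptotics.

(* Main.v *)
(* Diagonalize [T] and [T'] greedily. The vectors [e n] tensor [e' k] diagonalize
   the tensor product, so its eigenvalues are the products [lam n * lam' k], in
   decreasing order, and [N(t)] counts the pairs with [lam n * lam' k > t]. By
   Dirichlet's hyperbola method this number is
     sum_(lam' k > sqrt t) N(t / lam' k, T) + sum_(lam n > sqrt t) N(t / lam n, T')
     - N(sqrt t, T) N(sqrt t, T').
   Divided by [phi(1/t) t^(-1/p)], the k-th term of the first sum is asymptotic to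
   the k-th term of [s_star], and for [t < (lam' k)^2] it is at most a constant times
   [ratio_sup phi (1 / lam' k) * (lam' k)^(1/p)]; cutting the eigenvalues into dyadic
   blocks bounds the sum of these majorants by the integral of
   [phi' * ratio_sup phi / sigma], so the limit may be taken termwise. The same
   bound at [sigma] close to [1 / sqrt t] shows that the last product is negligible.
   The condition [tau (ln phi)'(tau) -> 0] enters only through the doubling property
   of [phi] on large dyadic intervals. *)

Require Import Defs.
From HB Require Import structures.
From mathcomp Require Import all_boot all_order all_algebra.
From mathcomp Require Import complex finmap ring lra.
From mathcomp Require Import all_classical all_reals all_analysis measurable_realfun.

Import Order.TTheory GRing.Theory Num.Theory.
Import numFieldNormedType.Exports.

Local Open Scope classical_set_scope.
Local Open Scope ring_scope.

Set Implicit Arguments.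
Unset Strict Implicit.
Unset Printing Implicit Defensive.

(** * Scalars and inner products *)

(** [eigenvalues] is specified only through multiplicities, and [TT] is only known to be continuous
    and to act as prescribed on elementary tensors. So no spectral theorem is applied to [TT]: by
    density, [TT] kills every vector orthogonal to all [tens (e n) (e' k)]. This fixes the dimension
    of each eigenspace, and the sequence follows because multiplicities determine it. In the
    counting part the cut at [sqrt t] is dictated by [ratio_sup]: with [sigma = 1 / lam' k] and
    [tau = 1 / t], the condition [lam' k > sqrt t] says exactly that [tau > sigma ^+ 2], so the
    supremum bounds every term of that half uniformly in [t]. The two slowly varying factors need
    not be comparable; hence each half is controlled by an error relative to its own factor, and
    positive lower bounds for the two transforms convert these errors into one relative error of the
    sum. *)

Section ScalarField.
Context {R : realType} {K : numFieldType} {ofR : R -> K} {conj : K -> K}.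
Context (hK : scalar_field ofR conj).

Lemma ofR_rmorph : {g : {rmorphism R -> K} | ofR = g}.
Proof.
have : exists g : {rmorphism R -> K}, ofR = g.
  case: hK => //; first by exists (idfun : {rmorphism R -> R}).
  by exists (real_complex R).
exact: cid.
Qed.

Lemma ofR0 : ofR 0 = 0. Proof. by have [g ->] := ofR_rmorph; rewrite rmorph0. Qed.
Lemma ofR1 : ofR 1 = 1. Proof. by have [g ->] := ofR_rmorph; rewrite rmorph1. Qed.
Lemma ofRD a b : ofR (a + b) = ofR a + ofR b.
Proof. by have [g ->] := ofR_rmorph; rewrite rmorphD. Qed.
Lemma ofRM a b : ofR (a * b) = ofR a * ofR b.
Proof. by have [g ->] := ofR_rmorph; rewrite rmorphM. Qed.
Lemma ofRN a : ofR (- a) = - ofR a.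
Proof. by have [g ->] := ofR_rmorph; rewrite rmorphN. Qed.
Lemma ofRX a n : ofR (a ^+ n) = ofR a ^+ n.
Proof. by have [g ->] := ofR_rmorph; rewrite rmorphXn. Qed.

Lemma ofR_le a b : (ofR a <= ofR b) = (a <= b).
Proof. by case: hK => //=; rewrite lecR. Qed.

Lemma ofR_lt a b : (ofR a < ofR b) = (a < b).
Proof. by case: hK => //=; rewrite ltcR. Qed.

Lemma ofR_inj : injective ofR.
Proof. by move=> a b /eqP; rewrite eq_le !ofR_le -eq_le => /eqP. Qed.

Lemma ofR_ge0 a : (0 <= ofR a) = (0 <= a).
Proof. by rewrite -ofR0 ofR_le. Qed.

Lemma ofR_gt0 a : (0 < ofR a) = (0 < a).
Proof. by rewrite -ofR0 ofR_lt. Qed.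

(** Norms live in [K], which need not be totally ordered; this replaces them by reals, where suprema
    and linear arithmetic are available. *)
Lemma ge0_ofR z : 0 <= z -> exists2 r : R, 0 <= r & z = ofR r.
Proof.
case: hK z => [z z0|/= z z0]; first by exists z.
have : z \is Num.real by rewrite realE z0.
move=> /Creal_ImP; case: z z0 => a b /=; rewrite lecE/= => /andP[/eqP b0 a0] _.
by exists a => //; rewrite b0.
Qed.

Lemma conj_rmorph : {g : {rmorphism K -> K} | conj = g}.
Proof.
have : exists g : {rmorphism K -> K}, conj = g.
  case: hK => //; first by exists (idfun : {rmorphism R -> R}).
  by exists Num.conj.
exact: cid.
Qed.

Lemma conj0 : conj 0 = 0.
Proof. by have [g ->] := conj_rmorph; rewrite rmorph0. Qed.
Lemma conj_div a b : conj (a / b) = conj a / conj b.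
Proof. by have [g ->] := conj_rmorph; rewrite fmorph_div. Qed.
Lemma conj_ofR r : conj (ofR r) = ofR r.
Proof.
case: hK => //=; apply: conj_Creal.
by rewrite realE !lecR le_total.
Qed.
Lemma mul_conj z : z * conj z = `|z| ^+ 2.
Proof.
case: hK z => [z|z]; first by rewrite /= real_normK ?num_real// expr2.
by rewrite normCK.
Qed.

End ScalarField.

Section InnerProduct.
Context {R : realType} {K : numFieldType} {ofR : R -> K} {conj : K -> K}.
Context (hK : scalar_field ofR conj) {H : hilbertSpace conj}.
Implicit Types (x y z : H) (a : K).

Lemma dotDl x y z : '[x + y, z] = '[x, z] + '[y, z].
Proof. exact: linearDl. Qed.
Lemma dotBl x y z : '[x - y, z] = '[x, z] - '[y, z].
Proof. exact: linearBl. Qed.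
Lemma dotDr x y z : '[x, y + z] = '[x, y] + '[x, z].
Proof. exact: linearDr. Qed.
Lemma dotBr x y z : '[x, y - z] = '[x, y] - '[x, z].
Proof. exact: linearBr. Qed.
Lemma dot0l x : '[0, x] = 0.
Proof. exact: linear0l. Qed.
Lemma dot0r x : '[x, 0] = 0.
Proof. exact: linear0r. Qed.
Lemma dotZl a x y : '[a *: x, y] = a * '[x, y].
Proof. exact: linearZl_LR. Qed.
Lemma dotZr a x y : '[x, a *: y] = conj a * '[x, y].
Proof. exact: linearZr_LR. Qed.
Lemma dot_suml (I : Type) (r : seq I) (P : pred I) (E : I -> H) y :
  '[\sum_(i <- r | P i) E i, y] = \sum_(i <- r | P i) '[E i, y].
Proof. exact: linear_sumlz. Qed.
Lemma dotC x y : '[x, y] = conj '[y, x].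
Proof. by have := @hermitian_subproof _ _ _ _ (hdot H) x y; rewrite expr0 mul1r. Qed.

Lemma dot_eq0C x y : '[x, y] = 0 -> '[y, x] = 0.
Proof. by move=> xy0; rewrite dotC xy0 (conj0 hK). Qed.

Lemma cauchy_schwarz x y : `|'[x, y]| <= `|x| * `|y|.
Proof.
have [->|y0] := eqVneq y 0; first by rewrite dot0r !normr0 mulr0.
have yy : 0 < `|y| ^+ 2 by rewrite exprn_gt0// normr_gt0.
(* [c *: y] is the orthogonal projection of [x] on the line of [y]. *)
set c := '[x, y] / '[y, y].
have : 0 <= '[x - c *: y, x - c *: y] by rewrite -hnormE exprn_ge0.
have yyc : conj '[y, y] = '[y, y] by rewrite -dotC.
rewrite dotBl !dotBr !dotZl !dotZr.
rewrite [conj c](conj_div hK) yyc -[conj '[x, y]]dotC.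
rewrite {}/c -!hnormE.
have -> : `|x| ^+ 2 - '[y, x] / `|y| ^+ 2 * '[x, y] -
    ('[x, y] / `|y| ^+ 2 * '[y, x] -
     '[x, y] / `|y| ^+ 2 * ('[y, x] / `|y| ^+ 2 * `|y| ^+ 2)) =
    `|x| ^+ 2 - ('[x, y] * '[y, x]) / `|y| ^+ 2.
  by field; rewrite normr_eq0.
rewrite [X in '[x, y] * X]dotC (mul_conj hK) subr_ge0 ler_pdivrMr//.
by rewrite -exprMn ler_pXn2r// nnegrE ?mulr_ge0.
Qed.

Lemma dot_eq0_limit y z : (forall e : K, 0 < e -> exists2 x, '[x, z] = 0 & `|y - x| <= e) ->
  '[y, z] = 0.
Proof.
move=> h; apply/eqP; rewrite -normr_eq0; apply/negPn/negP => yz0.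
have {}yz0 : 0 < `|'[y, z]| by rewrite lt_def yz0 normr_ge0.
have z1 : 0 < 2 * (`|z| + 1) by rewrite mulr_gt0// ltr_wpDl.
have [x xz xy] := h _ (divr_gt0 yz0 z1).
have : `|'[y - x, z]| <= `|'[y, z]| / (2 * (`|z| + 1)) * `|z|.
  by rewrite (le_trans (cauchy_schwarz _ _))// ler_wpM2r.
rewrite dotBl xz subr0 => /(le_lt_trans)/(_ _) {}h.
suff : `|'[y, z]| < `|'[y, z]| by rewrite ltxx.
apply: h; rewrite mulrAC ltr_pdivrMr// ltr_pM2l//.
by rewrite mulrDr mulr1 mulrDl mul1r -addrA ltrDl ltr_wpDl.
Qed.

Lemma dot_eq0_all x : (forall y, '[x, y] = 0) -> x = 0.
Proof.
by move=> /(_ x); rewrite -hnormE => /eqP; rewrite sqrf_eq0 normr_eq0 => /eqP.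
Qed.

End InnerProduct.

(** * Diagonalization of compact operators *)

Section CompactOperators.
Context {R : realType} {K : numFieldType} (ofR : R -> K) {conj : K -> K}.
Context (hK : scalar_field ofR conj) {H : hilbertSpace conj}.
Context (T : {linear H -> H}) (cT : compact_operator T).

(** Compactness enters through a cluster point: beyond any [N] some image [T (u n)] is close to [y],
    so no subsequence has to be extracted. *)
Lemma compact_cluster (u : nat -> H) : (forall n, `|u n| <= 1) ->
  exists y, forall e : K, 0 < e -> forall N, exists2 n, (N <= n)%N & `|y - T (u n)| < e.
Proof.
move=> u1; have := cT; rewrite /compact_operator precompactE => /(_ ((T \o u) @ \oo)).
case.
  by exists 0%N => // n _; apply: subset_closure; exists (u n) => //=.
move=> y [_ Fy]; exists y => e e0 N.
have [z [[n Nn <-] yz]] := Fy [set T (u n) | n in [set n | (N <= n)%N]]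
  (ball y e) (ex_intro2 _ _ N I (fun n Nn => ex_intro2 _ _ n Nn erefl)) (nbhsx_ballx _ _ e0).
by exists n => //; move: yz; rewrite -ball_normE.
Qed.

Lemma arch_ofR (z : K) : 0 <= z -> exists n : nat, z < n%:R.
Proof.
move=> /(ge0_ofR hK)[r r0 ->]; exists (Num.bound r).
have -> : ((Num.bound r)%:R : K) = ofR (Num.bound r)%:R.
  by have [g ->] := ofR_rmorph hK; rewrite rmorph_nat.
by rewrite (ofR_lt hK) archi_boundP.
Qed.

(** Unit-ball vectors [u n] with [T (u n)] longer than [n] would have images accumulating at some
    [y], near which norms stay bounded. *)
Lemma compact_operator_bounded : exists2 C : R, 0 <= C &
  forall x, `|T x| <= ofR C * `|x|.
Proof.
suff [n hn] : exists n : nat, forall x, `|x| <= 1 -> `|T x| <= n%:R.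
  exists n%:R => // x; have [->|x0] := eqVneq x 0.
    by rewrite linear0 !normr0 mulr0.
  have x_gt0 : 0 < `|x| by rewrite normr_gt0.
  have -> : ofR n%:R = n%:R by have [g ->] := ofR_rmorph hK; rewrite rmorph_nat.
  rewrite -ler_pdivrMr// mulrC.
  have := hn (`|x|^-1 *: x); rewrite normrZ normfV normr_id mulVf ?gt_eqF// => /(_ (lexx _)).
  by rewrite linearZ/= normrZ normfV normr_id.
apply: contrapT => h.
have {}h n : exists x, `|x| <= 1 /\ ~ (`|T x| <= n%:R).
  apply: contrapT => nx; apply: h; exists n => x x1.
  by apply: contrapT => Tx; apply: nx; exists x.
have [u hu] := choice h.
have [y hy] := compact_cluster (fun n => (hu n).1).
have [N Ny] := arch_ofR (addr_ge0 (normr_ge0 y) ler01).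
have [n Nn yn] := hy 1 ltr01 N.
apply: (hu n).2; apply: le_trans (_ : N%:R <= _); last by rewrite ler_nat.
apply/ltW/(le_lt_trans _ Ny).
have -> : T (u n) = y - (y - T (u n)) by rewrite opprB addrC subrK.
by rewrite (le_trans (ler_normB _ _))// lerD2l ltW.
Qed.

Context (saT : selfadjoint T) (nnT : nonnegative_operator T).

Definition all_eigenvectors (W : set H) :=
  forall w, W w -> exists l : R, T w = ofR l *: w.

Definition orth (W : set H) := [set x : H | forall w, W w -> '[x, w] = 0].

Lemma orth_invariant W x : all_eigenvectors W -> orth W x -> orth W (T x).
Proof.
move=> eW Wx w Ww; rewrite saT; have [l ->] := eW _ Ww.
by rewrite dotZr Wx// mulr0.
Qed.

Lemma orthD W x y : orth W x -> orth W y -> orth W (x + y).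
Proof. by move=> Wx Wy w Ww; rewrite dotDl Wx// Wy// addr0. Qed.

Lemma orthZ W a x : orth W x -> orth W (a *: x).
Proof. by move=> Wx w Ww; rewrite dotZl Wx// mulr0. Qed.

(** The value is the norm of [T] on the complement of the vectors already chosen, attained at a unit
    eigenvector; the pair [(0, 0)] records that [T] vanishes there. *)
Definition top_eigenpair (W : set H) (lv : R * H) :=
  [/\ 0 <= lv.1, T lv.2 = ofR lv.1 *: lv.2, orth W lv.2,
      (forall x, orth W x -> `|T x| <= ofR lv.1 * `|x|) &
      (0 < lv.1 -> '[lv.2, lv.2] = 1) /\ (lv.1 = 0 -> lv.2 = 0)].

(* With [M] the norm of [T] on the orthogonal complement of [W] and [T x_k -> y]
   along a maximizing sequence, [x_k -> T y / M^2 =: x], [T x = y] and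
   [T^2 x = M^2 x]; then [T x + M x] is an eigenvector for [M], and it is nonzero
   because [-M] is not an eigenvalue. *)
Lemma top_eigenpair_exists W : all_eigenvectors W -> exists lv, top_eigenpair W lv.
Proof.
move=> eW.
pose S := [set r : R | 0 <= r /\ exists x, [/\ orth W x, `|x| <= 1 & `|T x| = ofR r]].
have [C C0 TC] := compact_operator_bounded.
have S0 : S 0.
  by split=> //; exists 0; split=> [w _||]; rewrite ?dot0l ?linear0 ?normr0 ?ler01 ?(ofR0 hK).
have Sub : has_sup S.
  split; first by exists 0.
  exists C => r [r0 [x [_ x1 xr]]]; rewrite -(ofR_le hK) -xr (le_trans (TC x))//.
  by rewrite ler_piMr// (ofR_ge0 hK).
pose M := sup S.
have M0 : 0 <= M by apply: sup_ubound => //; exact: Sub.2.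
have TM1 x : orth W x -> `|x| <= 1 -> `|T x| <= ofR M.
  move=> Wx x1; have [r r0 xr] := ge0_ofR hK (normr_ge0 (T x)).
  rewrite xr (ofR_le hK); apply: sup_ubound; first exact: Sub.2.
  by split=> //; exists x.
have TM x : orth W x -> `|T x| <= ofR M * `|x|.
  move=> Wx; have [->|x0] := eqVneq x 0; first by rewrite linear0 !normr0 mulr0.
  rewrite -ler_pdivrMr ?normr_gt0// mulrC.
  have := TM1 _ (orthZ `|x|^-1 Wx).
  rewrite normrZ normfV normr_id mulVf ?normr_eq0// => /(_ (lexx _)).
  by rewrite linearZ/= normrZ normfV normr_id.
have := M0; rewrite le_eqVlt => /predU1P[M00|Mgt0].
  exists (0, 0); split=> //=; first by rewrite linear0 scaler0.
  - by move=> w _; rewrite dot0l.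
  - by move=> x /TM; rewrite -M00.
  - by split; rewrite ?ltxx.
have Mk (k : nat) : exists x, [/\ orth W x, `|x| <= 1 & ofR (M - k.+1%:R^-1) < `|T x|].
  have [r [r0 [x [Wx x1 xr]]] Mr] := sup_adherent (ltac:(by rewrite invr_gt0) : 0 < k.+1%:R^-1) Sub.
  by exists x; split=> //; rewrite xr (ofR_lt hK).
have [u hu] := choice Mk.
have Wu n : orth W (u n) by have [] := hu n.
have u1 n : `|u n| <= 1 by have [] := hu n.
have Mu n : ofR (M - n.+1%:R^-1) < `|T (u n)| by have [] := hu n.
have [y hy] := compact_cluster u1.
have approx (r : R) : 0 < r -> exists n, [/\ `|y - T (u n)| <= ofR r,
    `|T y - ofR (M ^+ 2) *: u n| <= ofR r & ofR (M - r) <= `|T (u n)|].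
  move=> r0.
  (* The first bound controls the distance to [y] and the defect from maximality, the second the
     image of that distance under [T], the third makes the squared estimate [T2] at most
     [r ^+ 2 / 4]. *)
  pose d := Num.min (r / 2) (Num.min (r / (2 * (C + 1))) (r ^+ 2 / 4 / (2 * M ^+ 3))).
  have d0 : 0 < d.
    by rewrite /d !lt_min !divr_gt0 ?exprn_gt0 ?mulr_gt0 ?exprn_gt0 ?ltr_wpDl.
  have dr : d <= r / 2 by rewrite /d ge_min lexx.
  have dC : d <= r / (2 * (C + 1)) by rewrite /d !ge_min lexx orbT.
  have dM : d <= r ^+ 2 / 4 / (2 * M ^+ 3) by rewrite /d !ge_min lexx !orbT.
  move: d d0 dr dC dM => d d0 dr dC dM.
  have [n nd yn] := hy (ofR d) (ltac:(by rewrite (ofR_gt0 hK))) (Num.bound d^-1).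
  have n1d : n.+1%:R^-1 <= d.
    have d'0 : 0 <= d^-1 by rewrite invr_ge0 ltW.
    rewrite invf_ple ?posrE// (le_trans (ltW (archi_boundP d'0)))//.
    by rewrite ler_nat (leq_trans nd).
  (* With [a], [b], [c] the norms of [T (T (u n))], [T (u n)], [u n], the square equals a^2 - 2 M^2
     b^2 + M^4 c^2. As a <= M b and c <= 1, it is at most M^2 (M^2 - b^2), hence at most 2 M^3 d. *)
  have T2 : `|T (T (u n)) - ofR (M ^+ 2) *: u n| ^+ 2 <= ofR (r / 2) ^+ 2.
    have dT z : '[T (T z), z] = `|T z| ^+ 2 by rewrite saT -hnormE.
    have dT' z : '[z, T (T z)] = `|T z| ^+ 2 by rewrite -saT -hnormE.
    rewrite hnormE dotBl !dotBr !dotZl !dotZr -!hnormE dT dT' (conj_ofR hK).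
    have [a a0 an] := ge0_ofR hK (normr_ge0 (T (T (u n)))).
    have [b b0 bn] := ge0_ofR hK (normr_ge0 (T (u n))).
    have [c c0 cn] := ge0_ofR hK (normr_ge0 (u n)).
    have := Mu n; rewrite bn (ofR_lt hK) => Mb.
    have := TM1 _ (Wu n) (u1 n); rewrite bn (ofR_le hK) => bM.
    have := u1 n; rewrite cn -(ofR1 hK) (ofR_le hK) => c1.
    have := TM _ (orth_invariant eW (Wu n)); rewrite bn an -(ofRM hK) (ofR_le hK) => aMb.
    rewrite -!(ofRX hK) -!(ofRM hK) -!(ofRN hK) -!(ofRD hK) -!(ofRN hK) -!(ofRD hK) (ofR_le hK).
    have a2 : a ^+ 2 <= M ^+ 2 * b ^+ 2 by rewrite -exprMn ler_pXn2r// nnegrE mulr_ge0.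
    have c2 : M ^+ 2 * (M ^+ 2 * c ^+ 2) <= M ^+ 2 * M ^+ 2.
      by rewrite -!mulrA !ler_wpM2l ?exprn_ge0// -[leRHS]mulr1 ler_wpM2l ?exprn_ge0// exprn_ile1.
    have b2 : M ^+ 2 * (M ^+ 2 - b ^+ 2) <= d * (2 * M ^+ 3).
      have -> : M ^+ 2 * (M ^+ 2 - b ^+ 2) = (M - b) * (M ^+ 2 * (M + b)) by ring.
      apply: ler_pM; rewrite ?subr_ge0 ?mulr_ge0 ?addr_ge0 ?exprn_ge0//; last first.
        rewrite (_ : 2 * _ = M ^+ 2 * (M + M)); last by ring.
        by rewrite ler_wpM2l ?exprn_ge0// lerD2l.
      by rewrite lerBlDr addrC -lerBlDr (le_trans _ (ltW Mb))// lerB.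
    have : d * (2 * M ^+ 3) <= r ^+ 2 / 4.
      by rewrite -ler_pdivlMr// mulr_gt0// exprn_gt0.
    by rewrite exprMn exprVn; lra.
  exists n; split; first (rewrite (le_trans (ltW yn))// (ofR_le hK); lra).
    have -> : T y - ofR (M ^+ 2) *: u n = T (y - T (u n)) + (T (T (u n)) - ofR (M ^+ 2) *: u n).
      by rewrite linearB/= addrA subrK.
    rewrite (le_trans (ler_normD _ _))// (_ : r = r / 2 + r / 2) ?ofRD//; last by field.
    rewrite (ofRD hK) lerD//; last by rewrite -ler_sqr ?nnegrE ?(ofR_ge0 hK)// divr_ge0// ltW.
    rewrite (le_trans (TC _))// (le_trans (ler_wpM2l _ (ltW yn))) ?(ofR_ge0 hK)//.
    rewrite -(ofRM hK) (ofR_le hK) (le_trans (ler_wpM2l C0 dC))//.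
    have C1 : 0 < C + 1 by rewrite ltr_wpDl.
    rewrite (_ : C * _ = r / 2 * (C / (C + 1))); last by field; rewrite gt_eqF.
    have r20 : 0 <= r / 2 by rewrite divr_ge0// ltW.
    by rewrite -[leRHS]mulr1 ler_wpM2l// ler_pdivrMr// mul1r lerDl.
  rewrite (le_trans _ (ltW (Mu n)))// (ofR_le hK) lerB// (le_trans n1d)//; lra.
have T2y : T (T y) = ofR (M ^+ 2) *: y.
  apply/eqP; rewrite -subr_eq0 -normr_le0; apply/negPn/negP.
  have [b b0 bn] := ge0_ofR hK (normr_ge0 (T (T y) - ofR (M ^+ 2) *: y)).
  rewrite bn -(ofR0 hK) (ofR_le hK) -ltNge => bgt0.
  have C1 : 0 < C + M ^+ 2 + 1 by rewrite ltr_wpDl ?addr_ge0 ?exprn_ge0.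
  have [n [yn1 yn2 _]] := approx (b / (C + M ^+ 2 + 1)) (divr_gt0 bgt0 C1).
  set r := b / _ in yn1 yn2.
  have : `|T (T y) - ofR (M ^+ 2) *: y| <= ofR (C * r + M ^+ 2 * r).
    have -> : T (T y) - ofR (M ^+ 2) *: y =
      T (T y - ofR (M ^+ 2) *: u n) - ofR (M ^+ 2) *: (y - T (u n)).
      by rewrite linearB [T (ofR _ *: _)]linearZ/= scalerBr opprB addrA subrK.
    rewrite (le_trans (ler_normB _ _))// (ofRD hK) lerD//.
      by rewrite (le_trans (TC _))// (ofRM hK C) ler_wpM2l// (ofR_ge0 hK).
    rewrite normrZ (ofRM hK (M ^+ 2)) ger0_norm ?(ofR_ge0 hK) ?exprn_ge0//.
    by rewrite ler_wpM2l// (ofR_ge0 hK) exprn_ge0.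
  rewrite bn (ofR_le hK) leNgt => /negP; apply.
  rewrite -mulrDl /r mulrC mulrAC ltr_pdivrMr// ltr_pM2l// ltrDl//.
have WTy : orth W (T y).
  move=> w Ww; apply: (dot_eq0_limit hK) => e /[dup] /ltW /(ge0_ofR hK)[r _ ->].
  rewrite (ofR_gt0 hK) => r0; have [n [_ yn _]] := approx r r0.
  by exists (ofR (M ^+ 2) *: u n) => //; rewrite dotZl Wu ?mulr0.
have M20 : ofR (M ^+ 2) != 0 by rewrite gt_eqF// (ofR_gt0 hK) exprn_gt0.
have Wy : orth W y.
  have -> : y = (ofR (M ^+ 2))^-1 *: T (T y) by rewrite T2y scalerA mulVf ?scale1r.
  exact/orthZ/orth_invariant.
have y0 : y != 0.
  (* If [y] were 0, the norm of [T (u n)] would be at most M/3 and at least 2M/3. *)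
  apply/eqP => y0; have [n [yn _ Tn]] := approx (M / 3) (divr_gt0 Mgt0 (ltr0Sn _ 2)).
  have := le_trans Tn (_ : `|T (u n)| <= ofR (M / 3)).
  by rewrite (ofR_le hK) -normrN -sub0r -y0 => /(_ yn); lra.
pose v := T y + ofR M *: y.
have v0 : v != 0.
  apply/eqP => /eqP; rewrite addr_eq0 => /eqP Ty.
  have := nnT y; rewrite Ty -scaleNr dotZl -hnormE.
  have y2 : 0 < `|y| ^+ 2 by rewrite exprn_gt0// normr_gt0.
  by rewrite pmulr_lge0// oppr_ge0 -(ofR0 hK) (ofR_le hK) leNgt Mgt0.
have Wv : orth W v by apply: orthD => //; exact: orthZ.
have Tv : T v = ofR M *: v.
  by rewrite linearD linearZ/= T2y scalerDr scalerA addrC -(ofRM hK) -expr2.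
exists (M, `|v|^-1 *: v); split => //=; first by rewrite linearZ/= Tv !scalerA mulrC.
  exact: orthZ.
split=> [_|M00]; last by move: Mgt0; rewrite M00 ltxx.
by rewrite -hnormE normrZ normfV normr_id mulVf ?normr_eq0// expr1n.
Qed.

End CompactOperators.

Section Diagonalization.
Context {R : realType} {K : numFieldType} (ofR : R -> K) {conj : K -> K}.
Context (hK : scalar_field ofR conj) {H : hilbertSpace conj}.

(* When [T] has finite rank [r], [lam n] and [e n] vanish for [n >= r], so [e] is
   orthonormal only where [lam] is positive. *)
Definition diagonalizes (T : H -> H) (lam : R^nat) (e : nat -> H) :=
  [/\ nonincreasing_seq lam /\ (forall n, 0 <= lam n),
      forall n, T (e n) = ofR (lam n) *: e n,
      [/\ forall n, 0 < lam n -> '[e n, e n] = 1, forall n, lam n = 0 -> e n = 0 &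
      forall n m, n != m -> '[e n, e m] = 0],
      (forall n x, (forall i, (i < n)%N -> '[x, e i] = 0) ->
         `|T x| <= ofR (lam n) * `|x|) &
      forall r : R, 0 < r -> exists n, lam n < r].

Context (T : {linear H -> H}) (cT : compact_operator T).
Context (saT : selfadjoint T) (nnT : nonnegative_operator T).

Lemma diagonalizes_exists : exists lam e, diagonalizes T lam e.
Proof.
(* The pair [(0, 0)] only makes [step] total; [eW] shows that the sets [W n] built below always
   consist of eigenvectors. *)
have /choice[step hstep] : forall W : set H, exists lv : R * H,
    all_eigenvectors ofR T W -> top_eigenpair ofR T W lv.
  move=> W; case: (pselect (all_eigenvectors ofR T W)) => [eW|nW].
    by have [lv] := top_eigenpair_exists hK cT saT nnT eW; exists lv.
  by exists (0, 0).
pose W n := iter n (fun W => W `|` [set (step W).2]) set0.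
pose lam n := (step (W n)).1.
pose e n := (step (W n)).2.
have WE n : W n = [set e i | i in [set i | (i < n)%N]].
  elim: n => [|n IH]; first by apply/seteqP; split => // x [].
  rewrite /W iterS -/(W n) -/(e n) [in LHS]IH; apply/seteqP; split=> [x|x].
    by case=> [[i /= ni <-]|->]; [exists i => //=; rewrite ltnW|exists n => /=].
  case=> i /=; rewrite ltnS leq_eqVlt => /predU1P[-> <-|ni <-]; first by right.
  by left; exists i.
have eW n : all_eigenvectors ofR T (W n).
  elim: n => // n IH w [/IH//|->].
  by have [_ Te _ _ _] := hstep _ IH; exists (lam n).
have hn n := hstep _ (eW n).
have orthWE n x : (orth (W n) x) <-> (forall i, (i < n)%N -> '[x, e i] = 0).
  split=> [Wx i ni|h w].
    by apply: Wx; rewrite WE; exists i.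
  by rewrite WE => -[i /= ni <-]; apply: h.
have lam0 n : 0 <= lam n by have [] := hn n.
have eorth n m : (m < n)%N -> '[e n, e m] = 0.
  by move=> mn; have [_ _ /orthWE/(_ _ mn) ] := hn n.
have eorth2 n m : n != m -> '[e n, e m] = 0.
  rewrite neq_ltn => /orP[nm|/eorth//].
  by apply/(dot_eq0C hK)/eorth.
have ee n : 0 < lam n -> '[e n, e n] = 1 by have [_ _ _ _ [+ _]] := hn n; exact.
have Te n : T (e n) = ofR (lam n) *: e n by have [] := hn n.
have lamT n x : (forall i, (i < n)%N -> '[x, e i] = 0) -> `|T x| <= ofR (lam n) * `|x|.
  by move=> /orthWE; have [_ _ _ + _] := hn n; exact.
have e1 n : 0 < lam n -> `|e n| = 1.
  by move=> /ee; rewrite -hnormE => /eqP; rewrite sqrp_eq1// => /eqP.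
exists lam, e; split=> //.
- split=> //; apply/nonincreasing_seqP => n.
  have := lam0 n.+1; rewrite [0 <= _]le_eqVlt => /predU1P[<-//|ln].
  have := lamT n (e n.+1) (fun i ni => eorth _ _ (leqW ni)).
  by rewrite Te normrZ e1// !mulr1 ger0_norm ?(ofR_ge0 hK)// (ofR_le hK).
- by split=> // n; have [_ _ _ _ [_ +]] := hn n; exact.
(* If all [lam n] were at least [r], the [e n] would be orthonormal and the squared distance of
   [T (e n)] and [T (e m)] would be at least 2 r^2, yet two images within r/2 of a cluster point are
   at distance at most [r]. *)
- move=> r r0; apply: contrapT => hr.
  have rlam n : r <= lam n by rewrite leNgt; apply/negP => h; apply: hr; exists n.
  have lgt0 n : 0 < lam n by rewrite (lt_le_trans r0).
  have [|y hy] := compact_cluster cT (u := e); first by move=> n; rewrite e1.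
  have r20 : 0 < ofR (r / 2) by rewrite (ofR_gt0 hK) divr_gt0.
  have [n _ yn] := hy _ r20 0%N.
  have [m nm ym] := hy _ r20 n.+1.
  have : `|T (e n) - T (e m)| <= ofR r.
    have -> : T (e n) - T (e m) = (y - T (e m)) - (y - T (e n)).
      by rewrite opprB [RHS]addrC addrA subrK.
    rewrite (le_trans (ler_normB _ _))// (_ : r = r / 2 + r / 2); last by field.
    by rewrite (ofRD hK) lerD// ltW.
  rewrite -ler_sqr ?nnegrE ?(ofR_ge0 hK) ?(ltW r0)// hnormE !Te.
  rewrite dotBl !dotBr !dotZl !dotZr !(conj_ofR hK) !ee//.
  rewrite [in '[e m, e n]]eorth// (dot_eq0C hK (eorth _ _ nm)) !mulr0 subr0 sub0r opprK !mulr1.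
  rewrite -(ofRX hK) -!(ofRM hK) -(ofRD hK) (ofR_le hK).
  have := rlam n; have := rlam m => hm hn'.
  have : r ^+ 2 <= lam n * lam n by rewrite expr2 ler_pM// ltW.
  have : r ^+ 2 <= lam m * lam m by rewrite expr2 ler_pM// ltW.
  have : 0 < r ^+ 2 by rewrite exprn_gt0.
  lra.
Qed.

End Diagonalization.

(** * Multiplicities determine the eigenvalue sequence *)

Section EigenvalueSequence.
Context {R : realType} {K : numFieldType} (ofR : R -> K) {conj : K -> K}.
Context (hK : scalar_field ofR conj) {H : hilbertSpace conj}.

(** An eigenvector for [v], minus its projection on the [f i] with [mu i = v], is orthogonal to
    these by construction and to the others because their eigenvalues differ; completeness then
    makes it 0. The index type is free so that pairs are allowed, and the adjoint relation is asked
    only against the [f i], which is what is available for [TT]. *)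
Lemma eigenspace_has_dim (T : {linear H -> H}) (I : pointedType) (mu : I -> R)
    (f : I -> H) (v : R) (m : nat) :
  (forall z i, '[T z, f i] = ofR (mu i) * '[z, f i]) ->
  (forall i, T (f i) = ofR (mu i) *: f i) ->
  (forall i, 0 < mu i -> '[f i, f i] = 1) ->
  (forall i j, i <> j -> '[f i, f j] = 0) ->
  (forall z, (forall i, '[z, f i] = 0) -> T z = 0) ->
  0 < v -> ([set i | mu i = v] #= `I_m)%card ->
  has_dim (eigenvectors ofR T v) m.
Proof.
move=> Tadj Tf ff1 ff0 Tz v0; rewrite card_eq_sym => /card_set_bijP[g [gs ginj gsurj]].
pose e (k : 'I_m) := f (g k).
have mug (k : 'I_m) : mu (g k) = v by apply: gs => /=.
have ee (k : 'I_m) : '[e k, e k] = 1 by rewrite ff1 ?mug.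
have ee0 (k l : 'I_m) : k != l -> '[e k, e l] = 0.
  move=> kl; apply: ff0 => /ginj gkl; move/eqP: kl; apply; apply/val_inj/gkl.
    by rewrite inE/=.
  by rewrite inE/=.
have dote (a : 'I_m -> K) l : '[\sum_k a k *: e k, e l] = a l.
  rewrite dot_suml (bigD1 l)//= dotZl ee mulr1 big1 ?addr0// => k kl.
  by rewrite dotZl ee0// mulr0.
exists e; split=> [a a0 i|].
  by rewrite -dote a0 dot0l.
apply/seteqP; split=> [x /= Tx|_ [a _ <-]]; last first.
  rewrite /eigenvectors/=.
  rewrite linear_sum scaler_sumr; apply: eq_bigr => k _.
  by rewrite linearZ/= Tf mug scalerA mulrC -scalerA.
exists (fun k => '[x, e k]) => //; apply/esym/eqP; rewrite -subr_eq0.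
set y := x - _.
have Ty : T y = ofR v *: y.
  rewrite linearB/= Tx linear_sum scalerBr; congr (_ - _).
  rewrite scaler_sumr; apply: eq_bigr => k _.
  by rewrite linearZ/= Tf mug scalerA mulrC -scalerA.
have v0' : ofR v != 0 by rewrite gt_eqF// (ofR_gt0 hK).
suff /Tz/eqP : forall i, '[y, f i] = 0.
  by rewrite Ty scaler_eq0 (negbTE v0').
move=> i; have [iv|iv] := eqVneq (mu i) v.
  have [k km <-] := gsurj _ iv.
  by have := dote (fun k => '[x, e k]) (Ordinal km); rewrite /y dotBl => ->; rewrite subrr.
have := Tadj y i; rewrite Ty dotZl => /eqP.
rewrite -subr_eq0 -mulrBl mulf_eq0 subr_eq0 => /predU1P[/(ofR_inj hK) vi|/eqP//].
by rewrite vi eqxx in iv.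
Qed.

(** Writing each family in terms of the other gives matrices with product the identity of size [n],
    and factoring through size [m] forces [n <= m]. *)
Lemma has_dim_le (E : set H) n m : has_dim E n -> has_dim E m -> (n <= m)%N.
Proof.
move=> [e [free_e Ee]] [f [_ Ef]].
have e_in i : E (e i).
  rewrite Ee; exists (fun j => (j == i)%:R) => //.
  rewrite (bigD1 i)//= eqxx scale1r big1 ?addr0// => j /negbTE->.
  by rewrite scale0r.
have f_in j : E (f j).
  rewrite Ef; exists (fun k => (k == j)%:R) => //.
  rewrite (bigD1 j)//= eqxx scale1r big1 ?addr0// => k /negbTE->.
  by rewrite scale0r.
have /choice[A hA] : forall i, exists a : 'I_m -> K, \sum_j a j *: f j = e i.
  by move=> i; have := e_in i; rewrite Ef => -[a _ <-]; exists a.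
have /choice[B hB] : forall j, exists b : 'I_n -> K, \sum_i b i *: e i = f j.
  by move=> j; have := f_in j; rewrite Ee => -[b _ <-]; exists b.
apply: (@mulmx1_min _ _ _ (\matrix_(i, j) A i j) (\matrix_(j, i) B j i)).
apply/matrixP => i k; rewrite !mxE.
suff: \sum_(l < n) (\sum_j A i j * B j l - (i == l)%:R) *: e l = 0.
  by move/free_e/(_ k)/eqP; rewrite subr_eq0 => /eqP <-; apply: eq_bigr => j _; rewrite !mxE.
under eq_bigr do rewrite scalerBl.
rewrite sumrB.
have -> : \sum_l (i == l)%:R *: e l = e i.
  rewrite (bigD1 i)//= eqxx scale1r big1 ?addr0// => l.
  by rewrite eq_sym => /negbTE->; rewrite scale0r.
apply/eqP; rewrite subr_eq0 -[X in _ == X]hA; apply/eqP.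
under [RHS]eq_bigr do rewrite -hB scaler_sumr.
rewrite exchange_big/=; apply: eq_bigr => l _; rewrite scaler_suml.
by apply: eq_bigr => j _; rewrite scalerA.
Qed.

Lemma sub_card_eq {T : choiceType} (A B : set T) m :
  A `<=` B -> (A #= `I_m)%card -> (B #= `I_m)%card -> A = B.
Proof.
move=> AB Am Bm.
have Af : finite_set A by apply/finite_setP; exists m.
have Bf : finite_set B by apply/finite_setP; exists m.
apply: fset_set_inj => //; apply/eqP.
rewrite eqEfcard (card_fset_set Am) (card_fset_set Bm) leqnn andbT.
by rewrite -fset_set_sub.
Qed.

(** Suppose [lam n < lam' n =: v]. By monotonicity every index with [lam k = v] lies below [n],
    where the sequences agree, so it also satisfies [lam' k = v]. Both index sets have the same
    finite size, hence coincide, although [n] belongs only to the second. *)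
Lemma eigenvalue_sequence_le (T : H -> H) (lam lam' : R^nat) n :
  eigenvalue_sequence ofR T lam -> eigenvalue_sequence ofR T lam' ->
  (forall i, (i < n)%N -> lam i = lam' i) -> lam' n <= lam n.
Proof.
move=> [dlam lam0 hlam] [dlam' lam'0 hlam'] eq_lam.
rewrite leNgt; apply/negP => lam_lt.
have v0 : 0 < lam' n by rewrite (le_lt_trans (lam0 n)).
have [m [lamm dimm]] := hlam _ v0; have [m' [lamm' dimm']] := hlam' _ v0.
have mm' : m = m'.
  by apply/eqP; rewrite eqn_leq (has_dim_le dimm dimm') (has_dim_le dimm' dimm).
suff seteq : [set k | lam k = lam' n] = [set k | lam' k = lam' n].
  have : [set k | lam' k = lam' n] n by [].
  by rewrite -seteq /= => lamn; rewrite lamn ltxx in lam_lt.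
rewrite -mm' in lamm'; apply: (sub_card_eq _ lamm lamm') => k /= lamk.
have [kn|nk] := ltnP k n; first by rewrite -eq_lam.
by have := dlam _ _ nk; rewrite lamk leNgt lam_lt.
Qed.

Lemma eigenvalue_sequence_unique (T : H -> H) (lam lam' : R^nat) :
  eigenvalue_sequence ofR T lam -> eigenvalue_sequence ofR T lam' -> lam = lam'.
Proof.
move=> hlam hlam'; apply/funext => n.
elim/ltn_ind: n => n IH; apply/eqP; rewrite eq_le.
by apply/andP; split; apply: (eigenvalue_sequence_le (T := T)) => // i /IH.
Qed.

Lemma eigenvaluesE (T : H -> H) (lam : R^nat) :
  eigenvalue_sequence ofR T lam -> eigenvalues ofR T = lam.
Proof.
move=> hlam; apply: (eigenvalue_sequence_unique (T := T)) => //.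
by apply: xgetPex; exists lam.
Qed.

End EigenvalueSequence.

(** * Decreasing rearrangements and tensor products *)

Section Rearrangement.
Context {R : realType}.
Implicit Types (lam : R^nat).

(** This is the right-continuity of the counting function; it makes both inequalities in
    [rearrangementP] strict. *)
Lemma gap_above {I : Type} (F : I -> R) (s : seq I) (t : R) :
  all (fun i => t < F i) s -> exists2 t', t < t' & all (fun i => t' < F i) s.
Proof.
elim: s => [_|i s IH /= /andP[ti /IH[t' tt' st']]]; first by exists (t + 1); rewrite ?ltrDl.
exists (Num.min t' ((t + F i) / 2)); first by rewrite lt_min tt' midf_lt.
rewrite gt_min midf_lt// orbT /=; apply: sub_all st' => j.
by rewrite gt_min => ->.
Qed.

Lemma gap_below {I : Type} (F : I -> R) (s : seq I) (t : R) :
  all (fun i => F i < t) s -> exists2 t', t' < t & all (fun i => F i < t') s.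
Proof.
move=> st; have [|t' tt' st'] := @gap_above _ (fun i => - F i) s (- t).
  by apply: sub_all st => i /=; rewrite ltrN2.
exists (- t'); first by rewrite ltrNl.
by apply: sub_all st' => i /=; rewrite ltrNr.
Qed.

Section Family.
Context {I : choiceType} (F : I -> R).
Context (F_finite : forall t, 0 < t -> finite_set [set i | t < F i]).

Definition count_above (t : R) : nat := #|` fset_set [set i | t < F i]|.

Lemma count_above_mono t t' : 0 < t -> (forall i, t < F i -> t' < F i) -> 0 < t' ->
  (count_above t <= count_above t')%N.
Proof.
move=> t0 tt' t'0; apply: fsubset_leq_card.
by rewrite -fset_set_sub; [|exact: F_finite..].
Qed.

(** The generalized inverse of the counting function. The alternative [t = 0] keeps the set
    inhabited and pads with zeros once the positive values are exhausted. *)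
Definition rearrangement : R^nat := fun j =>
  sup [set t : R | t = 0 \/ (0 < t /\ (j < count_above t)%N)].

Context (B : R) (FB : forall i, F i <= B).

Lemma has_sup_rearrangement j :
  has_sup [set t : R | t = 0 \/ (0 < t /\ (j < count_above t)%N)].
Proof.
split; first by exists 0; left.
exists (Num.max 0 B) => t [->|[t0 jt]]; first by rewrite le_max lexx.
have [x] : exists x, x \in fset_set [set i | t < F i].
  apply/fset0Pn; rewrite -cardfs_gt0.
  exact: leq_ltn_trans jt.
rewrite in_fset_set; last exact: F_finite.
by rewrite inE/= => ti; rewrite le_max (le_trans (ltW ti) (FB x)) orbT.
Qed.

Lemma rearrangement_ge0 j : 0 <= rearrangement j.
Proof. by apply: sup_ubound; [exact: (has_sup_rearrangement j).2|left]. Qed.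

Lemma rearrangementP t j : 0 < t -> (j < count_above t)%N = (t < rearrangement j).
Proof.
move=> t0; apply/idP/idP => [jt|tj].
  have tfin := F_finite t0.
  have [|t' tt' t'F] := @gap_above _ F (fset_set [set i | t < F i]) t.
    by apply/allP => i; rewrite in_fset_set// inE.
  apply: (lt_le_trans tt'); apply: sup_ubound; first exact: (has_sup_rearrangement j).2.
  right; have t'0 : 0 < t' by rewrite (lt_trans t0).
  split=> //; apply: (leq_trans jt); apply: count_above_mono => // i ti.
  by move/allP : t'F; apply; rewrite in_fset_set// inE.
have d0 : 0 < rearrangement j - t by rewrite subr_gt0.
have [t' ht' tt'] := sup_adherent d0 (has_sup_rearrangement j).
rewrite -/(rearrangement j) opprB addrCA subrr addr0 in tt'.
case: ht' => [t'0|[t'0 jt']]; first by move: tt'; rewrite t'0 ltNge ltW.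
by apply: (leq_trans jt'); apply: count_above_mono => // i; apply: lt_trans.
Qed.

Lemma rearrangement_nonincreasing : nonincreasing_seq rearrangement.
Proof.
apply/nonincreasing_seqP => n; rewrite leNgt; apply/negP => lt_n.
have n0 : 0 < (rearrangement n + rearrangement n.+1) / 2.
  by rewrite divr_gt0// ltr_wpDl ?rearrangement_ge0// (le_lt_trans _ lt_n)// rearrangement_ge0.
have := midf_lt lt_n => -[l1 l2].
have := l2; rewrite -rearrangementP// => /ltnW.
by rewrite -/(_ < _)%N rearrangementP// ltNge ltW.
Qed.

Lemma card_rearrangement v : 0 < v -> exists m,
  ([set j | rearrangement j = v] #= `I_m)%card /\ ([set i | F i = v] #= `I_m)%card.
Proof.
move=> v0; have v20 : 0 < v / 2 by rewrite divr_gt0.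
(* Only finitely many values exceed [v / 2], so some threshold [t0 < v] leaves no value strictly
   between [t0] and [v]. Both multiplicities of [v] are then the drop of the counting function from
   [t0] to [v]. *)
have [|t1 t1v t1F] := @gap_below _ F [seq i <- fset_set [set i | v / 2 < F i] | F i < v] v.
  by apply/allP => i; rewrite mem_filter => /andP[].
pose t0 := Num.max (v / 2) t1.
have t00 : 0 < t0 by rewrite lt_max v20.
have t0v : t0 < v by rewrite gt_max t1v andbT ltr_pdivrMr// mulr2n mulrDr mulr1 ltrDl.
have t0F i : t0 < F i -> v <= F i.
  rewrite gt_max leNgt => /andP[vi t1i]; apply/negP => iv.
  have : i \in [seq i <- fset_set [set i | v / 2 < F i] | F i < v].
    by rewrite mem_filter iv in_fset_set ?inE//; exact: F_finite.
  by move/allP: t1F => /[apply]; rewrite ltNge ltW.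
exists (count_above t0 - count_above v)%N; split.
  rewrite (_ : [set j | _] = `I_(count_above t0) `\` `I_(count_above v)) ?card_IID//.
  apply/seteqP; split=> j /=.
    by rewrite !rearrangementP// => ->; rewrite ltxx.
  rewrite !rearrangementP// => -[t0j /negP]; rewrite -leNgt => jv.
  apply/eqP; rewrite eq_le jv leNgt; apply/negP => jltv.
  pose t := (rearrangement j + v) / 2.
  have [jt tv] := midf_lt jltv.
  have tpos : 0 < t by rewrite (le_lt_trans (rearrangement_ge0 j)).
  have : (j < count_above t)%N.
    rewrite -rearrangementP// in t0j; apply: (leq_trans t0j).
    by apply: count_above_mono => // i /t0F; apply: lt_le_trans.
  by rewrite rearrangementP// ltNge ltW.
have Fv : finite_set [set i | F i = v].
  by apply: sub_finite_set (F_finite t00) => i /= ->.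
rewrite -(fset_setK Fv); apply/card_eq_fsetP.
rewrite (_ : [set i | F i = v] = [set i | t0 < F i] `\` [set i | v < F i]); last first.
  apply/seteqP; split=> i /=; first by move=> ->; rewrite ltxx.
  by move=> [/t0F vi /negP]; rewrite -leNgt => iv; apply/eqP; rewrite eq_le iv.
have F1 := F_finite t00; have F2 := F_finite v0.
rewrite fset_setD// cardfsDS// -fset_set_sub// => i /=; exact: lt_trans.
Qed.

End Family.

Lemma vanishing_initial_segment lam t : nonincreasing_seq lam ->
  (forall r, 0 < r -> exists n, lam n < r) -> 0 < t ->
  exists N, [set i | t < lam i] = `I_N.
Proof.
move=> dlam lam0 t0; have /ex_minnP[N lamN minN] : exists n, lam n <= t.
  by have [n lnt] := lam0 t t0; exists n; rewrite ltW.
exists N; apply/seteqP; split=> i /=; last first.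
  by rewrite ltNge => iN; apply: contraL iN => /minN; rewrite -leqNgt.
move=> ti; rewrite ltnNge; apply/negP => /dlam Ni.
by have := lt_le_trans ti (le_trans Ni lamN); rewrite ltxx.
Qed.

Lemma vanishing_finite lam : nonincreasing_seq lam ->
  (forall r, 0 < r -> exists n, lam n < r) ->
  forall t, 0 < t -> finite_set [set i | t < lam i].
Proof.
by move=> dlam lam0 t /(vanishing_initial_segment dlam lam0)[N ->]; exact: finite_II.
Qed.

Lemma count_above_seq lam t j : nonincreasing_seq lam ->
  (forall r, 0 < r -> exists n, lam n < r) -> 0 < t ->
  (j < count_above lam t)%N = (t < lam j).
Proof.
move=> dlam lam0 /(vanishing_initial_segment dlam lam0)[N tN].
rewrite /count_above tN (card_fset_set (card_eqxx _)).
by have /(congr1 (fun A => A j)) := tN; rewrite /= => /is_true_inj ->.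
Qed.

End Rearrangement.

Section DiagonalOperators.
Context {R : realType} {K : numFieldType} (ofR : R -> K) {conj : K -> K}.
Context (hK : scalar_field ofR conj).

Section OneOperator.
Context {H : hilbertSpace conj}.
Context (T : {linear H -> H}) (lam : R^nat) (e : nat -> H).
Context (De : diagonalizes ofR T lam e).

Lemma diagonalizes_complete z : (forall n, '[z, e n] = 0) -> T z = 0.
Proof.
case: De => [[_ lam0] _ _ Tlam lam_to0] ze.
have Tz n : `|T z| <= ofR (lam n) * `|z| by apply: Tlam => i _; exact: ze.
have [a a0 az] := ge0_ofR hK (normr_ge0 (T z)).
have [b b0 bz] := ge0_ofR hK (normr_ge0 z).
apply/eqP; rewrite -normr_le0 az -(ofR0 hK) (ofR_le hK) leNgt; apply/negP => agt0.
have b1 : 0 < b + 1 by rewrite ltr_wpDl.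
have [n ln] := lam_to0 (a / (b + 1)) (divr_gt0 agt0 b1).
have := Tz n; rewrite az bz -(ofRM hK) (ofR_le hK) leNgt => /negP; apply.
rewrite (@le_lt_trans _ _ (lam n * (b + 1)))//; last by rewrite -ltr_pdivlMr.
by rewrite ler_wpM2l// lerDl.
Qed.

Lemma diagonalizes_eigenvalue_sequence : selfadjoint T -> eigenvalue_sequence ofR T lam.
Proof.
move=> saT; have [[dlam lam0] Te [ee _ eorth] _ lam_to0] := De.
split=> // v v0.
have Ffin := vanishing_finite dlam lam_to0.
have [m [_ lamm]] := card_rearrangement Ffin (B := lam 0%N) (fun i => dlam _ _ (leq0n i)) v0.
exists m; split=> //; apply: (eigenspace_has_dim hK (I := nat) (mu := lam) (f := e)) => //.
- by move=> z i; rewrite saT Te dotZr (conj_ofR hK).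
- by move=> i j /eqP/eorth.
- exact: diagonalizes_complete.
Qed.

(** Puts the range of [T] in the closed span of the [e n]: removing from [u] its projection on the
    first [n] vectors does not lengthen it, and [T] has norm at most [lam n] on what is left. *)
Lemma diagonalizes_approx u (r : R) : 0 < r -> exists n (a : 'I_n -> K),
  `|T u - \sum_i a i *: e i| <= ofR r.
Proof.
move=> r0; have [[dlam lam0] Te [ee e0 eorth] Tlam lam_to0] := De.
have [b b0 bu] := ge0_ofR hK (normr_ge0 u).
have b1 : 0 < b + 1 by rewrite ltr_wpDl.
have [n ln] := lam_to0 (r / (b + 1)) (divr_gt0 r0 b1).
pose q := \sum_(i < n) '[u, e i] *: e i.
have qe i : (i < n)%N -> '[u - q, e i] = 0.
  move=> ni; have := lam0 i; rewrite le_eqVlt => /predU1P[/esym/e0->|li].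
    by rewrite dot0r.
  rewrite dotBl dot_suml (bigD1 (Ordinal ni))//= dotZl ee// mulr1 big1 ?addr0 ?subrr//.
  by move=> k kni; rewrite dotZl eorth ?mulr0.
have uq : '[u - q, q] = 0.
  apply: (dot_eq0C hK); rewrite dot_suml big1// => i _.
  by rewrite dotZl (dot_eq0C hK (qe _ (ltn_ord i))) mulr0.
have uq_le : `|u - q| <= `|u|.
  have uu : '[u, u] = '[u - q, u - q] + '[q, q].
    rewrite -{1 2}(subrK q u) (dotDl (u - q) q) (dotDr (u - q) (u - q) q).
    by rewrite (dotDr q (u - q) q) uq (dot_eq0C hK uq) addr0 add0r.
  by rewrite -ler_sqr ?nnegrE// !hnormE uu lerDl -hnormE exprn_ge0.
exists n, (fun i : 'I_n => '[u, e i] * ofR (lam i)).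
have -> : T u - \sum_(i < n) ('[u, e i] * ofR (lam i)) *: e i = T (u - q).
  rewrite linearB [T q]linear_sum/=; congr (_ - _); apply: eq_bigr => i _.
  by rewrite linearZ/= Te scalerA.
rewrite (le_trans (Tlam n _ qe))// (le_trans (ler_wpM2l _ uq_le)) ?(ofR_ge0 hK)//.
rewrite bu -(ofRM hK) (ofR_le hK) (@le_trans _ _ (lam n * (b + 1)))//.
  by rewrite ler_wpM2l// lerDl.
by rewrite -ler_pdivlMr// ltW.
Qed.

(** The bounded map [B] will be the tensor product with a fixed vector on either side, which lets
    the two factors be treated one after the other. *)
Lemma diagonalizes_image_orth {HH : hilbertSpace conj} (B : {linear H -> HH}) (C : K) z u :
  0 <= C -> (forall x, `|B x| <= C * `|x|) -> (forall n, '[z, B (e n)] = 0) ->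
  '[z, B (T u)] = 0.
Proof.
move=> C0 BC zB; apply/(dot_eq0C hK)/(dot_eq0_limit hK) => eps eps0.
have C1 : 0 < C + 1 by rewrite ltr_wpDl.
have [r r0 rE] := ge0_ofR hK (ltW (divr_gt0 eps0 C1)).
have rgt0 : 0 < r by rewrite -(ofR_gt0 hK) -rE divr_gt0.
have [n [a Ta]] := diagonalizes_approx u rgt0.
exists (B (\sum_i a i *: e i)).
  rewrite linear_sum dot_suml big1// => i _.
  by rewrite linearZ/= dotZl (dot_eq0C hK) ?mulr0.
rewrite -linearB (le_trans (BC _))// (le_trans (ler_wpM2l C0 Ta))// -rE.
rewrite (@le_trans _ _ ((C + 1) * (eps / (C + 1))))//.
  by rewrite ler_wpM2r ?lerDl// ltW// divr_gt0.
by rewrite mulrC mulfVK// gt_eqF.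
Qed.

End OneOperator.

Section Tensor.
Context {H H' HH : hilbertSpace conj}.
Context (tens : {bilinear H -> H' -> HH}) (htens : hilbert_tensor tens).

Lemma tensZ a b x y : tens (a *: x) (b *: y) = (a * b) *: tens x y.
Proof. by rewrite linearZl_LR linearZr_LR scalerA. Qed.

Lemma norm_tens x y : `|tens x y| = `|x| * `|y|.
Proof.
apply/eqP; rewrite -(eqrXn2 (n := 2))// ?mulr_ge0//.
by rewrite exprMn !hnormE htens.1.
Qed.

(** Identities checked on elementary tensors extend by additivity, density and continuity. It is
    used with [L = TT] for the adjoint relation and with the identity to show that a vector
    vanishes. *)
Lemma tens_dense_ext (L : HH -> HH) (w w' : HH) :
  (forall a b, L (a - b) = L a - L b) -> (forall a b, L (a + b) = L a + L b) -> L 0 = 0 ->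
  continuous L -> (forall x y, '[L (tens x y), w] = '[tens x y, w']) ->
  forall z, '[L z, w] = '[z, w'].
Proof.
move=> LB LD L0 cL Lw z; apply/eqP; rewrite -subr_eq0 -normr_le0.
apply/negPn/negP => nd0; set d := '[L z, w] - '[z, w'] in nd0.
have d0 : 0 < `|d| by rewrite normr_gt0 -normr_le0.
have w1 : 0 < 2 * (`|w| + 1) by rewrite mulr_gt0// ltr_wpDl.
have w'1 : 0 < 2 * (`|w'| + 1) by rewrite mulr_gt0// ltr_wpDl.
have e0 := divr_gt0 d0 w1; have e'0 := divr_gt0 d0 w'1.
have near_z : nbhs z [set y | `|L z - L y| < `|d| / (2 * (`|w| + 1)) /\
                              `|z - y| < `|d| / (2 * (`|w'| + 1))].
  apply: filterI.
    by have /cvgrPdist_lt/(_ _ e0) := cL z.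
  by have := nbhsx_ballx z _ e'0; apply: filterS => y; rewrite -ball_normE.
have : closure [set v : HH | exists (n : nat) (x : 'I_n -> H) (y : 'I_n -> H'),
    v = \sum_i tens (x i) (y i)] z by rewrite htens.2.
move=> /(_ _ near_z)[_ [[n [x [y ->]]] [Lzy zy]]].
set q := \sum_i _ in Lzy zy.
have Lq : '[L q, w] = '[q, w'].
  rewrite dot_suml -(eq_bigr _ (fun i _ => Lw (x i) (y i))) -dot_suml; congr '[_, _].
  exact: (big_morph L LD L0).
suff : `|d| < `|d| by rewrite ltxx.
have {1}-> : d = '[L z - L q, w] - '[z - q, w'].
  by rewrite !dotBl Lq opprB addrA subrK.
rewrite (le_lt_trans (ler_normB _ _))//.
rewrite (@lt_le_trans _ _ (`|d| / 2 + `|d| / 2))//; last first.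
  by rewrite -splitr.
have bound (v : HH) (x1 : HH) : `|x1| < `|d| / (2 * (`|v| + 1)) -> `|'[x1, v]| < `|d| / 2.
  move=> xv; rewrite (le_lt_trans (cauchy_schwarz hK _ _))//.
  have v1 : 0 < `|v| + 1 by rewrite ltr_wpDl.
  rewrite (@le_lt_trans _ _ (`|x1| * (`|v| + 1)))//.
    by rewrite ler_wpM2l// lerDl.
  by rewrite -ltr_pdivlMr// -mulrA -invfM.
by apply: ltrD; exact: bound.
Qed.

Context (T : {linear H -> H}) (T' : {linear H' -> H'}) (TT : {linear HH -> HH}).
Context (saT : selfadjoint T) (saT' : selfadjoint T') (hTT : tensor_operator tens T T' TT).

Lemma tensor_operator_adjoint z x y : '[TT z, tens x y] = '[z, tens (T x) (T' y)].
Proof.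
apply: tens_dense_ext => //; first exact: linearB.
- exact: linearD.
- exact: linear0.
- exact: hTT.1.
- by move=> a b; rewrite hTT.2 !htens.1 saT saT'.
Qed.

Context (lam lam' : R^nat) (e : nat -> H) (e' : nat -> H').
Context (De : diagonalizes ofR T lam e) (De' : diagonalizes ofR T' lam' e').

(** Orthogonality passes from [tens (e n) (e' k)] to [tens (T u) (e' k)] and then to
    [tens (T u) (T' v)]. By the adjoint relation [TT z] is therefore orthogonal to all elementary
    tensors, which span a dense subspace. *)
Lemma tensor_complete z : (forall n k, '[z, tens (e n) (e' k)] = 0) -> TT z = 0.
Proof.
move=> zee.
have zTe u k : '[z, tens (T u) (e' k)] = 0.
  pose B : {linear H -> HH} := applyr tens (e' k).
  apply: (diagonalizes_image_orth De (B := B) (C := `|e' k|)) => // [x|n].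
    by rewrite /B/= norm_tens mulrC.
  exact: zee.
have zTT u v : '[z, tens (T u) (T' v)] = 0.
  pose B : {linear H' -> HH} := tens (T u).
  apply: (diagonalizes_image_orth De' (B := B) (C := `|T u|)) => // [x|n].
    by rewrite /B/= norm_tens.
  exact: zTe.
apply: dot_eq0_all => y; apply: (dot_eq0C hK).
have -> : '[y, TT z] = '[y, (0 : HH)]; last by rewrite dot0r.
apply: (tens_dense_ext (L := idfun)) => // [a|a b]; first exact: cvg_id.
by rewrite /= dot0r; apply: (dot_eq0C hK); rewrite tensor_operator_adjoint.
Qed.

Lemma counting_function_tensor t : 0 < t ->
  counting_function ofR t TT = (count_above (fun nk => lam nk.1 * lam' nk.2) t)%:R.
Proof.
pose F (nk : nat * nat) := lam nk.1 * lam' nk.2.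
have [[dlam lam0] Te [ee e0 eorth] _ lam_to0] := De.
have [[dlam' lam'0] Te' [ee' e'0 eorth'] _ lam'_to0] := De'.
have FB nk : F nk <= lam 0%N * lam' 0%N by rewrite ler_pM ?dlam ?dlam'.
have Ffin t0 : 0 < t0 -> finite_set [set nk | t0 < F nk].
  move=> t00.
  have pos (a : R) : 0 <= a -> 0 < t0 / (a + 1) by move=> a0; rewrite divr_gt0// ltr_wpDl.
  (* A product above [t0] confines each index, since the other factor is at most its first term;
     adding 1 keeps the denominators positive. *)
  apply: (sub_finite_set (B := [set n | t0 / (lam' 0%N + 1) < lam n] `*`
                               [set n | t0 / (lam 0%N + 1) < lam' n])); last first.
    by apply: finite_setX; apply: vanishing_finite => //; exact: pos.
  move=> [n k] /= tF; split; rewrite ltr_pdivrMr ?ltr_wpDl//; apply: (lt_le_trans tF).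
    by rewrite ler_wpM2l// (le_trans (dlam' _ _ (leq0n k)))// lerDl.
  by rewrite /F/= mulrC ler_wpM2l// (le_trans (dlam _ _ (leq0n n)))// lerDl.
have mu_seq : eigenvalue_sequence ofR TT (rearrangement F).
  split; [exact: (rearrangement_nonincreasing Ffin FB)|exact: (rearrangement_ge0 Ffin FB)|].
  move=> v v0; have [m [mum Fm]] := card_rearrangement Ffin FB v0.
  exists m; split=> //.
  pose f (nk : nat * nat) := tens (e nk.1) (e' nk.2).
  apply: (eigenspace_has_dim hK (I := (nat * nat)%type) (mu := F) (f := f)) => //.
  - move=> z [n k]; rewrite tensor_operator_adjoint Te Te'/=.
    by rewrite tensZ -(ofRM hK) dotZr (conj_ofR hK).
  - by move=> [n k]; rewrite /f/= hTT.2 Te Te' tensZ -(ofRM hK).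
  - move=> [n k]; rewrite /F/f/= htens.1 => nk0.
    have n0 : lam n != 0 by apply: contraTneq nk0 => ->; rewrite mul0r ltxx.
    have k0 : lam' k != 0 by apply: contraTneq nk0 => ->; rewrite mulr0 ltxx.
    by rewrite ee ?ee' ?mulr1// lt_def ?n0 ?k0/=.
  - move=> [n k] [n' k'] nk; rewrite /f/= htens.1.
    have [nn|nn] := eqVneq n n'; last by rewrite eorth// mul0r.
    have [kk|kk] := eqVneq k k'; last by rewrite eorth'// mulr0.
    by rewrite nn kk in nk.
  - by move=> z zf; apply: tensor_complete => n k; exact: (zf (n, k)).
move=> t0; rewrite /counting_function (eigenvaluesE mu_seq) -/F.
suff -> : [set n | t < rearrangement F n] = `I_(count_above F t).
  by rewrite (card_fset_set (card_eqxx _)).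
by apply/seteqP; split=> n /=; rewrite (rearrangementP Ffin FB).
Qed.

End Tensor.

Lemma counting_functionE {H : hilbertSpace conj} (T : {linear H -> H}) lam e t :
  selfadjoint T -> diagonalizes ofR T lam e ->
  counting_function ofR t T = (count_above lam t)%:R.
Proof.
by move=> saT De; rewrite /counting_function
  (eigenvaluesE (diagonalizes_eigenvalue_sequence De saT)).
Qed.

End DiagonalOperators.

(** * Asymptotics of the number of products *)

Section Hyperbola.
Context {R : realType} (lam lam' : R^nat).
Context (dlam : nonincreasing_seq lam) (dlam' : nonincreasing_seq lam').
Context (lam0 : forall n, 0 <= lam n) (lam'0 : forall n, 0 <= lam' n).
Context (lam_to0 : forall r, 0 < r -> exists n, lam n < r).
Context (lam'_to0 : forall r, 0 < r -> exists n, lam' n < r).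

Local Notation c := (count_above lam).
Local Notation c' := (count_above lam').

Lemma sum_ltn N m : (m <= N)%N -> (\sum_(n < N) (n < m))%N = m.
Proof.
move=> mN; rewrite -(big_mkord xpredT (fun n => (n < m)%N : nat)).
rewrite (big_cat_nat (leq0n m) mN)/=.
have -> : (\sum_(0 <= n < m) (n < m) = \sum_(0 <= n < m) 1)%N.
  by apply: eq_big_nat => n /andP[_ ->].
have -> : (\sum_(m <= n < N) (n < m) = \sum_(m <= n < N) 0)%N.
  by apply: eq_big_nat => n /andP[mn _]; rewrite ltnNge mn.
by rewrite !sum_nat_const_nat subn0 muln1 muln0 addn0.
Qed.

Lemma sum_lt_count (mu : R^nat) N t : nonincreasing_seq mu ->
  (forall r, 0 < r -> exists n, mu n < r) -> 0 < t -> (count_above mu t <= N)%N ->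
  (\sum_(n < N) (t < mu n)%R)%N = count_above mu t.
Proof.
move=> dmu mu0 t0 /sum_ltn <-; apply: eq_bigr => n _.
by rewrite (count_above_seq _ dmu).
Qed.

Lemma count_product_bound t n k : 0 < t -> t < lam n * lam' k ->
  (n < c (t / (lam' 0%N + 1)))%N /\ (k < c' (t / (lam 0%N + 1)))%N.
Proof.
move=> t0 tnk; have l1 : 0 < lam 0%N + 1 by rewrite ltr_wpDl.
have l'1 : 0 < lam' 0%N + 1 by rewrite ltr_wpDl.
rewrite (count_above_seq _ dlam)// ?divr_gt0// (count_above_seq _ dlam')// ?divr_gt0//.
rewrite !ltr_pdivrMr//; split; apply: (lt_le_trans tnk).
  by rewrite ler_wpM2l// (le_trans (dlam' (leq0n k)))// lerDl.
by rewrite mulrC ler_wpM2l// (le_trans (dlam (leq0n n)))// lerDl.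
Qed.

Lemma sum_lt_count_product N t : 0 < t ->
  (c (t / (lam' 0%N + 1)) <= N)%N -> (c' (t / (lam 0%N + 1)) <= N)%N ->
  (\sum_(n < N) \sum_(k < N) (t < lam n * lam' k)%R)%N =
  count_above (fun nk => (lam nk.1 * lam' nk.2)%R) t.
Proof.
move=> t0 cN c'N; pose f (p : 'I_N * 'I_N) := (val p.1, val p.2).
have f_inj : injective f by move=> [a b] [a' b'] [/val_inj-> /val_inj->].
pose A := [pred p : 'I_N * 'I_N | t < lam p.1 * lam' p.2].
have setE : [set nk : nat * nat | t < lam nk.1 * lam' nk.2] = [set` [fset f p | p in A]%fset].
  apply/seteqP; split=> [[n k] /= tnk|nk /= /imfsetP[[n k] /= tnk ->]//].
  have [nc kc] := count_product_bound t0 tnk.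
  apply/imfsetP; exists (Ordinal (leq_trans nc cN), Ordinal (leq_trans kc c'N)) => //=.
rewrite /count_above setE set_fsetK card_imfset//=.
rewrite -cardE -sum1_card pair_big/= [RHS]big_mkcond/=.
by apply: eq_bigr => -[n k] _; rewrite inE/=; case: ifP.
Qed.

(** If the product exceeds [r ^+ 2], one factor exceeds [r], so the two sums cover all counted
    pairs. A pair is covered twice when both factors exceed [r], and every such pair is counted,
    which gives the full rectangle on the left. *)
Lemma hyperbola_identity (r : R) : 0 < r ->
  (count_above (fun nk => (lam nk.1 * lam' nk.2)%R) (r ^+ 2)%R + c r * c' r =
   \sum_(k < c' r) c (r ^+ 2 / lam' k)%R + \sum_(n < c r) c' (r ^+ 2 / lam n)%R)%N.
Proof.
move=> r0; set t := r ^+ 2; have t0 : 0 < t by rewrite exprn_gt0.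
have l1 : 0 < lam 0%N + 1 by rewrite ltr_wpDl.
have l'1 : 0 < lam' 0%N + 1 by rewrite ltr_wpDl.
pose N := maxn (maxn (c r) (c' r))
  (maxn (c (t / (lam' 0%N + 1))) (c' (t / (lam 0%N + 1)))).
have crN : (c r <= N)%N by rewrite !leq_max leqnn.
have c'rN : (c' r <= N)%N by rewrite !leq_max leqnn !orbT.
have cN : (c (t / (lam' 0%N + 1)) <= N)%N by rewrite !leq_max leqnn !orbT.
have c'N : (c' (t / (lam 0%N + 1)) <= N)%N by rewrite !leq_max leqnn !orbT.
(* Each half becomes a sum of indicators over one common square of side [N], so the identity can be
   checked pair by pair. *)
have half (mu nu : R^nat) : nonincreasing_seq mu -> nonincreasing_seq nu ->
    (forall n, 0 <= mu n) -> (forall n, 0 <= nu n) ->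
    (forall r, 0 < r -> exists n, mu n < r) -> (forall r, 0 < r -> exists n, nu n < r) ->
    (count_above nu r <= N)%N -> (count_above mu (t / (nu 0%N + 1)) <= N)%N ->
    (\sum_(k < count_above nu r) count_above mu (t / nu k)%R =
     \sum_(k < N) \sum_(n < N) ((r < nu k) && (t < mu n * nu k))%R)%N.
  move=> dmu dnu mu0 nu0 mu_to0 nu_to0 nuN muN.
  rewrite (big_ord_widen _ (fun k => count_above mu (t / nu k)%R) nuN) big_mkcond/=.
  apply: eq_bigr => k _; rewrite (count_above_seq _ dnu)//.
  case: ifP => rk; last by rewrite big1.
  have k0 : 0 < nu k by rewrite (lt_trans r0).
  rewrite -(@sum_lt_count mu N)// ?divr_gt0//.
    by apply: eq_bigr => n _; rewrite ltr_pdivrMr.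
  apply: leq_trans muN; apply: count_above_mono; rewrite ?divr_gt0 ?ltr_wpDl//.
    exact: vanishing_finite.
  move=> n; apply: le_lt_trans; rewrite ler_pM2l// lef_pV2 ?posrE ?ltr_wpDl//.
  by rewrite (le_trans (dnu _ _ (leq0n k)))// lerDl.
rewrite (half lam lam')// (half lam' lam)//.
rewrite -(sum_lt_count_product t0 cN c'N).
rewrite -(sum_lt_count dlam lam_to0 r0 crN) -(sum_lt_count dlam' lam'_to0 r0 c'rN).
rewrite [X in (_ = X + _)%N]exchange_big/=.
rewrite big_distrl/= -!big_split/=; apply: eq_bigr => n _.
rewrite big_distrr/= -!big_split/=; apply: eq_bigr => k _.
rewrite [lam' k * _]mulrC.
have [rn|nr] := ltP r (lam n); have [rk|kr] := ltP r (lam' k) => //=;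
  rewrite ?muln0 ?mul0n ?addn0//.
  by rewrite muln1 addnC /t expr2 ltr_pM // ltW.
suff -> : t < lam n * lam' k = false by [].
by apply/negbTE; rewrite -leNgt /t expr2 ler_pM.
Qed.

End Hyperbola.

(** * Integrals bounded below by dyadic sums *)

Section DyadicIntegral.
Context {R : realType}.
Local Open Scope ereal_scope.

(** The integrands of interest contain [ratio_sup], a supremum over an uncountable family.
    Monotonicity is therefore read off the supremum over simple functions: those below [g] are also
    below [f]. *)
Lemma ge0_le_integral_lower (D : set R) (g f : R -> \bar R) :
  (forall x, D x -> 0 <= g x) -> (forall x, D x -> g x <= f x) ->
  \int[lebesgue_measure]_(x in D) g x <= \int[lebesgue_measure]_(x in D) f x.
Proof.
move=> g0 gf; have f0 x : D x -> 0 <= f x by move=> Dx; rewrite (le_trans (g0 _ Dx) (gf _ Dx)).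
rewrite !ge0_integralE//; apply: le_ereal_sup => _ [h hg <-]; exists h => //.
move=> x; apply: (le_trans (hg x)); rewrite /patch; case: ifPn => // /set_mem Dx.
exact: gf.
Qed.

(* No measurability of [f] is needed: the integral of a nonnegative function is a
   supremum over the simple functions below it. *)
Lemma dyadic_sum_le_integral (f : R -> \bar R) (d : nat -> \bar R) j0 :
  (forall x, (1 <= x)%R -> 0 <= f x) -> (forall j, 0 <= d j) ->
  (forall j x, (j0 <= j)%N -> (2 ^+ j <= x < 2 ^+ j.+1)%R -> ((2 ^+ j)^-1)%:E * d j <= f x) ->
  forall J, \sum_(j0 <= j < J) d j <= \int[lebesgue_measure]_(x in `[1%R, +oo[) f x.
Proof.
move=> f0 d0 df J.
pose A j : set R := `[(2 ^+ j)%R, (2 ^+ j.+1)%R[%classic.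
(* The height is [d j] divided by the length [2 ^+ j] of the interval, so that [g j] has integral
   [d j]. *)
pose g j x := ((2 ^+ j)^-1)%:E * d j * (\1_(A j) x)%:E.
have pow0 j : (0 < 2 ^+ j :> R)%R by rewrite exprn_gt0.
have pow1 j : (1 <= 2 ^+ j :> R)%R by rewrite exprn_ege1// ler1n.
have c0 j : 0 <= ((2 ^+ j)^-1)%:E * d j by rewrite mule_ge0// lee_fin invr_ge0 ltW.
have g0 j x : 0 <= g j x by rewrite mule_ge0// lee_fin.
have mg j : measurable_fun (`[1%R, +oo[%classic : set R) (g j).
  apply: measurable_funeM; apply/measurable_EFinP.
  by apply: measurable_indic; exact: measurable_itv.
have intg j : \int[lebesgue_measure]_(x in `[1%R, +oo[) g j x = d j.
  have mA : measurable_fun (`[1%R, +oo[%classic : set R) (fun x => (\1_(A j) x)%:E : \bar R).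
    by apply/measurable_EFinP; apply: measurable_indic; exact: measurable_itv.
  rewrite ge0_integralZl//.
  rewrite integral_indic; [|exact: measurable_itv..].
  rewrite setIidl; last first.
    move=> x; rewrite /A/= !in_itv/= andbT => /andP[+ _]; exact: le_trans.
  have muA : lebesgue_measure (A j) = (2 ^+ j)%:E :> \bar R.
    rewrite /A lebesgue_measure_itv/= lte_fin exprS ltr_pMl// ?ltr1n//.
    by rewrite -EFinB (_ : _ - _ = 2 ^+ j)%R//; ring.
  transitivity (((2 ^+ j)^-1)%:E * d j * (2 ^+ j)%:E); first by congr (_ * _).
  by rewrite muleAC -EFinM mulVf ?gt_eqF// mul1e.
rewrite -(eq_bigr _ (fun j _ => intg j)) -ge0_integral_sum//.
apply: ge0_le_integral_lower => x /=; rewrite in_itv/= andbT => x1.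
  by apply: sume_ge0.
have g_out j : ~ (2 ^+ j <= x < 2 ^+ j.+1)%R -> g j x = 0.
  by move=> xj; rewrite /g indicE memNset ?mule0//= in_itv.
have [[j jJ xj]|nx] := pselect (exists2 j, (j0 <= j < J)%N & (2 ^+ j <= x < 2 ^+ j.+1)%R).
  rewrite (bigD1_seq j)/= ?mem_index_iota ?iota_uniq// big1 ?adde0; last first.
    move=> i ij; apply: g_out => /andP[ix xi]; case/andP: xj => jx xj.
    case/negP: ij; rewrite eqn_leq -(ltnS i) -(ltnS j).
    rewrite -!(@ltr_eXn2l R 2%R) ?ltr1n//.
    by rewrite (le_lt_trans ix xj) (le_lt_trans jx xi).
  rewrite /g indicE mem_set ?mule1; last by rewrite /A/= in_itv.
  by apply: df => //; case/andP: jJ.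
rewrite big_nat_cond big1 ?f0// => j /andP[jJ _]; apply: g_out => xj.
by apply: nx; exists j.
Qed.

End DyadicIntegral.

Lemma bound_lt_pow2 {R : realType} (x : R) j : 0 <= x -> (Num.bound x <= j)%N -> x < 2 ^+ j.
Proof.
move=> x0 xj; rewrite (lt_le_trans (archi_boundP x0))// -natrX ler_nat (leq_trans xj)//.
by rewrite ltnW// ltn_expl.
Qed.

Lemma pow2_inv_lt {R : realType} (r : R) : 0 < r -> exists j, (2 ^+ j)^-1 < r.
Proof.
move=> r0; exists (Num.bound r^-1); rewrite invf_plt ?posrE ?exprn_gt0//.
by rewrite bound_lt_pow2// invr_ge0 ltW.
Qed.

(** * Slowly varying functions on dyadic scales *)

Section SlowVariation.
Context {R : realType}.
Implicit Types (phi psi : R -> R).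

Local Notation e1 := (expR 1 : R).

Lemma regular_gt0 phi tau : regular_slowly_varying phi -> 0 < tau -> 0 < phi tau.
Proof. by move=> [[h _ _] _ _ _]; exact: h. Qed.

(** The mean value theorem for [ln phi]: once |x (ln phi)'(x)| <= 1, the increment over [[y, z]] is
    at most (z - y) / x <= 1, because z - y <= y < x. This is the source of the constant [expR 1],
    and it replaces an appeal to uniform convergence in the definition of slow variation. *)
Lemma regular_doubling phi : regular_slowly_varying phi ->
  exists2 y0 : R, 1 <= y0 & forall y z, y0 <= y -> y <= z <= 2 * y ->
    phi z <= e1 * phi y /\ phi y <= e1 * phi z.
Proof.
move=> [[phi_gt0 _ _] phiC2 + _]; pose g x := ln (phi x); rewrite -/g.
move=> /cvgrPdist_le/(_ 1 ltr01)[M [_ gM]].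
exists (Num.max 1 (M + 1)); first by rewrite le_max lexx.
move=> y z; rewrite ge_max => /andP[y1 My] /andP[yz zy].
have y0 : 0 < y by rewrite (lt_le_trans ltr01).
have dg x : 0 < x -> derivable g x 1.
  move=> x0; apply: diff_derivable; apply: differentiable_comp.
    by apply/derivable1_diffP; have [] := phiC2 x x0.
  apply/derivable1_diffP/ex_derive; apply: is_derive1_ln; exact: phi_gt0.
have gyz : `|g z - g y| <= 1.
  move: yz; rewrite le_eqVlt => /predU1P[<-|yz]; first by rewrite subrr normr0.
  have [||x xyz ->] := @MVT R g (derive1 g) y z yz.
  - move=> x; rewrite in_itv/= => /andP[yx _]; rewrite derive1E.
    by apply/derivableP/dg; rewrite (lt_trans y0).
  - apply: derivable_within_continuous => x; rewrite in_itv/= => /andP[yx _].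
    by apply: dg; rewrite (lt_le_trans y0).
  move: xyz; rewrite in_itv/= => /andP[yx xz].
  have x0 : 0 < x by rewrite (lt_trans y0).
  have := gM x (lt_le_trans _ (ltW (le_lt_trans My yx))).
  rewrite sub0r normrN ltrDl => /(_ ltr01); rewrite !normrM (gtr0_norm x0) => gx.
  rewrite (le_trans _ gx)// mulrC ler_wpM2r// gtr0_norm ?subr_gt0//.
  by rewrite lerBlDr; lra.
have phiE x : 0 < x -> phi x = expR (g x) by move=> x0; rewrite lnK// posrE phi_gt0.
have z0 : 0 < z by rewrite (lt_le_trans y0).
rewrite !phiE// -!expRD !ler_expR; move: gyz; rewrite ler_norml => /andP[]; lra.
Qed.

Lemma ratio_sup_ge0 phi sigma : regular_slowly_varying phi -> 1 <= sigma ->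
  (0 <= ratio_sup phi sigma)%E.
Proof.
move=> hphi s1; have phi_gt0 tau := regular_gt0 (tau := tau) hphi.
have s0 : 0 < sigma by rewrite (lt_le_trans ltr01).
apply: (@le_trans _ _ (phi ((sigma ^+ 2 + 1) / sigma) / phi (sigma ^+ 2 + 1))%:E).
  have s2 : 0 < sigma ^+ 2 + 1 by rewrite ltr_wpDl// exprn_ge0// ltW.
  by rewrite lee_fin ltW// divr_gt0 ?phi_gt0// divr_gt0.
by apply: ereal_sup_ubound; exists (sigma ^+ 2 + 1) => //=; rewrite ltrDl.
Qed.

(** The ratios tend to 1 as [tau] grows. The lower bound lets constants, such as the bound of [s],
    be absorbed into the same majorants as the ratios of [phi]. *)
Lemma ratio_sup_ge_half phi sigma : regular_slowly_varying phi -> 0 < sigma ->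
  ((1 / 2)%:E <= ratio_sup phi sigma)%E.
Proof.
move=> [[phi_gt0 _ phi_sv] _ _ _] s0.
have s'0 : 0 < sigma^-1 by rewrite invr_gt0.
have [M [_ phiM]] := (cvgrPdist_le _ _).1 (phi_sv _ s'0) (1 / 2) (divr_gt0 ltr01 (ltr0Sn _ 1)).
pose tau := Num.max M (sigma ^+ 2) + 1.
have Mtau : M < tau by rewrite /tau ltr_pwDr// le_max lexx.
have stau : sigma ^+ 2 < tau by rewrite /tau ltr_pwDr// le_max lexx orbT.
apply: (@le_trans _ _ (phi (tau / sigma) / phi tau)%:E); last first.
  by apply: ereal_sup_ubound; exists tau.
by have := phiM _ Mtau; rewrite lee_fin ler_norml [sigma^-1 * _]mulrC => /andP[]; lra.
Qed.

(** A larger [sigma] admits fewer [tau], and the points [tau / sigma'] and [tau / sigma] differ by a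
    factor at most 2 and lie beyond [y0]. *)
Lemma ratio_sup_doubling phi y0 sigma sigma' : regular_slowly_varying phi -> 1 <= y0 ->
  (forall y z, y0 <= y -> y <= z <= 2 * y -> phi z <= e1 * phi y /\ phi y <= e1 * phi z) ->
  y0 <= sigma -> sigma <= sigma' <= 2 * sigma ->
  (ratio_sup phi sigma' <= e1%:E * ratio_sup phi sigma)%E.
Proof.
move=> [[phi_gt0 _ _] _ _ _] y01 phi2 ys /andP[ss ss'].
have s0 : 0 < sigma by rewrite (lt_le_trans ltr01)// (le_trans y01).
have s'0 : 0 < sigma' by rewrite (lt_le_trans s0).
apply: ge_ereal_sup => _ [tau /= st <-].
have st' : sigma ^+ 2 < tau by rewrite (le_lt_trans _ st)// ler_sqr// nnegrE ltW.
have tau0 : 0 < tau by rewrite (lt_trans _ st)// exprn_gt0.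
apply: (@le_trans _ _ (e1%:E * (phi (tau / sigma) / phi tau)%:E)%E); last first.
  rewrite lee_pmul2l ?fin_numE ?lte_fin ?expR_gt0//.
  by apply: ereal_sup_ubound; exists tau.
have phitau : 0 <= (phi tau)^-1 by rewrite invr_ge0 ltW// phi_gt0.
rewrite -EFinM lee_fin mulrA ler_wpM2r//.
apply: (phi2 _ _ _ _).2.
  by rewrite (le_trans ys)// (le_trans ss)// ler_pdivlMr// -expr2 ltW.
rewrite ler_pM2l// lef_pV2 ?posrE// ss/= mulrCA ler_pM2l//.
by rewrite ler_pdivlMr// mulrC ler_pdivrMr.
Qed.

Lemma dyadic_majorant phi psi :
  regular_slowly_varying phi -> regular_slowly_varying psi ->
  (\int[lebesgue_measure]_(sigma in `[1%R, +oo[)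
     ((psi sigma / sigma)%:E * ratio_sup phi sigma) < +oo)%E ->
  exists (M : nat -> R) (j0 : nat) (B : R), [/\
    forall j, (j0 <= j)%N -> 1 / 2 <= M j,
    forall j tau, (j0 <= j)%N -> (2 ^+ j) ^+ 2 < tau -> phi (tau / 2 ^+ j) <= M j * phi tau &
    forall J, \sum_(j0 <= j < J) psi (2 ^+ j) * M j <= B].
Proof.
move=> hphi hpsi int_fin; set I := (\int[_]_(_ in _) _)%E in int_fin.
have [[phi_gt0 _ _] _ _ _] := hphi; have [[psi_gt0 _ _] _ _ _] := hpsi.
have [y0 y01 phi2] := regular_doubling hphi; have [z0 z01 psi2] := regular_doubling hpsi.
pose j0 := Num.bound (Num.max y0 z0).
have pow0 j : 0 < 2 ^+ j :> R by rewrite exprn_gt0.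
have pow1 j : 1 <= 2 ^+ j :> R by rewrite exprn_ege1// ler1n.
have j0P j : (j0 <= j)%N -> y0 <= 2 ^+ j /\ z0 <= 2 ^+ j.
  move=> jj; suff : Num.max y0 z0 <= 2 ^+ j by rewrite ge_max => /andP[].
  have yz0 : 0 <= Num.max y0 z0 by rewrite le_max (le_trans ler01 y01).
  by rewrite ltW// bound_lt_pow2.
pose m j := ratio_sup phi (2 ^+ j).
have m0 j : (0 <= m j)%E by exact: ratio_sup_ge0.
(* The integrand on a dyadic interval is compared with its right end, as [ratio_sup_doubling] bounds
   it only from smaller to larger [sigma]. One factor [e1] is lost for [psi], one for
   [ratio_sup phi], and the 2 for [1 / x]. *)
pose a j := psi (2 ^+ j.+1) / (2 * e1 ^+ 2).
have a0 j : 0 < a j by rewrite divr_gt0 ?psi_gt0// mulr_gt0 ?exprn_gt0 ?expR_gt0.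
have sum_le J : (\sum_(j0 <= j < J) (a j)%:E * m j.+1 <= I)%E.
  apply: dyadic_sum_le_integral => [x x1|j|j x jj /andP[jx xj]].
  - have x0 : 0 < x by rewrite (lt_le_trans ltr01).
    by rewrite mule_ge0 ?ratio_sup_ge0// lee_fin ltW// divr_gt0 ?psi_gt0.
  - by rewrite mule_ge0// lee_fin ltW.
  have x0 : 0 < x by rewrite (lt_le_trans (pow0 j)).
  have [yj zj] := j0P _ jj.
  have jx2 : x <= 2 ^+ j.+1 <= 2 * x by rewrite (ltW xj)/= exprS ler_pM2l.
  have mx : (m j.+1 <= e1%:E * ratio_sup phi x)%E.
    by apply: (ratio_sup_doubling hphi y01 phi2) => //; rewrite (le_trans yj).
  have [psix _] := psi2 _ _ (le_trans zj jx) jx2.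
  rewrite muleA -EFinM.
  apply: (@le_trans _ _ (((2 ^+ j)^-1 * a j)%:E * (e1%:E * ratio_sup phi x))%E).
    by rewrite lee_wpmul2l// lee_fin mulr_ge0 ?invr_ge0// ltW.
  rewrite muleA -EFinM lee_wpmul2r ?ratio_sup_ge0 ?(le_trans (pow1 j) jx)// lee_fin.
  have e0 : 0 < e1 by rewrite expR_gt0.
  rewrite (_ : _ * e1 = psi (2 ^+ j.+1) / e1 / 2 ^+ j.+1); last first.
    by rewrite /a exprS; field; rewrite !gt_eqF.
  apply: ler_pM.
  - by rewrite divr_ge0 ?ltW// psi_gt0.
  - by rewrite invr_ge0 ltW.
  - by rewrite ler_pdivrMr// mulrC.
  - by rewrite lef_pV2 ?posrE// ltW.
(* An infinite [m j.+1] with positive coefficient [a j] would make the integral infinite. The shift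
   from [j] to [j.+1] is why the majorants start at [j0.+1]. *)
have m_fin j : (j0 < j)%N -> m j \is a fin_num.
  case: j => // j jj; rewrite fin_numE -ltey; apply/andP; split.
    by rewrite gt_eqF// (lt_le_trans _ (m0 _)).
  have /(le_lt_trans (sum_le j.+1))/(le_lt_trans _) := int_fin.
  move=> /(_ ((a j)%:E * m j.+1)%E) h; move: h.
  rewrite big_nat_recr//= => /(_ _); rewrite leeDr; last first.
    by apply: sume_ge0 => i _; rewrite mule_ge0// lee_fin ltW.
  move=> /(_ isT); rewrite !ltey; apply: contra => /eqP ->.
  by rewrite gt0_muley// lte_fin.
have I_fin : I \is a fin_num.
  rewrite fin_numE -ltey int_fin andbT gt_eqF// (lt_le_trans (ltNye 0))//.
  by have := sum_le 0%N; rewrite big_geq.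
exists (fun j => fine (m j)), j0.+1, (2 * e1 ^+ 2 * fine I); split.
- move=> j jj; rewrite -lee_fin fineK ?m_fin//.
  exact: ratio_sup_ge_half.
- move=> j tau jj jtau; rewrite -ler_pdivrMr ?phi_gt0 ?(lt_trans _ jtau) ?exprn_gt0//.
  rewrite -lee_fin fineK ?m_fin//; apply: ereal_sup_ubound; by exists tau.
- move=> [|J].
    rewrite big_geq// !mulr_ge0 ?exprn_ge0 ?expR_ge0 ?fine_ge0//.
    by have := sum_le 0%N; rewrite big_geq.
  rewrite big_add1/= (_ : \sum_(_ <= _ < _) _ =
    2 * e1 ^+ 2 * \sum_(j0 <= j < J) a j * fine (m j.+1)).
    rewrite ler_pM2l ?mulr_gt0 ?exprn_gt0 ?expR_gt0// -lee_fin fineK// (le_trans _ (sum_le J))//.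
    rewrite -sumEFin big_nat_cond [leRHS]big_nat_cond; apply: lee_sum => j /andP[/andP[jj _] _].
    by rewrite EFinM fineK// m_fin.
  rewrite mulr_sumr; apply: eq_bigr => j _; rewrite /a.
  by field; rewrite gt_eqF// expR_gt0.
Qed.

End SlowVariation.

Section Tails.
Context {R : realType}.

Lemma bounded_tail (D : nat -> R) j0 (B : R) : (forall j, (j0 <= j)%N -> 0 <= D j) ->
  (forall J, \sum_(j0 <= j < J) D j <= B) ->
  forall e, 0 < e -> exists2 J, (j0 <= J)%N &
    forall J1 J', (J <= J1)%N -> \sum_(J1 <= j < J') D j <= e.
Proof.
move=> D0 DB e e0; pose P J := \sum_(j0 <= j < J) D j.
have hS : has_sup (range P).
  by split; [exists (P 0%N); exists 0%N|exists B => _ [J _ <-]; exact: DB].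
have [_ [J _ <-] PJ] := sup_adherent e0 hS.
exists (maxn j0 J); first by rewrite leq_maxl.
move=> J1 J'; rewrite geq_max => /andP[j0J1 JJ1].
have [J'J1|/ltnW J1J'] := leqP J' J1; first by rewrite big_geq// ltW.
have PJ' : P J' <= sup (range P) by apply: sup_ubound; [exact: hS.2|exists J'].
have PE : P J' = P J1 + \sum_(J1 <= j < J') D j by rewrite /P (big_cat_nat j0J1 J1J').
have PJ1 : P J <= P J1.
  have [j0J|/ltnW Jj0] := leqP j0 J.
    rewrite /P (big_cat_nat j0J JJ1)/= lerDl big_nat_cond.
    apply: sumr_ge0 => j /andP[/andP[Jj _] _].
    by rewrite D0// (leq_trans j0J).
  rewrite /P big_geq// big_nat_cond; apply: sumr_ge0 => j /andP[/andP[Jj _] _].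
  by rewrite D0.
move: PJ PJ' PJ1; rewrite PE; lra.
Qed.

Lemma block_sum_le (n : nat -> nat) (G h : nat -> R) J J' :
  {homo n : i j / (i <= j)%N} -> (J <= J')%N ->
  (forall j k, (J <= j)%N -> (n j <= k < n j.+1)%N -> G k <= h j) ->
  (forall j, (J <= j)%N -> 0 <= h j) ->
  \sum_(n J <= k < n J') G k <= \sum_(J <= j < J') (n j.+1)%:R * h j.
Proof.
move=> ndn /subnKC <-; elim: (J' - J)%N => [|m IH] Gh h0; first by rewrite addn0 !big_geq.
rewrite addnS (@big_cat_nat _ _ _ (n (J + m)%N))/=; [|by rewrite ndn ?leq_addr|by rewrite ndn].

rewrite big_nat_recr ?leq_addr//= lerD ?IH//.
have hm := h0 _ (leq_addr m J).
apply: (@le_trans _ _ (\sum_(n (J + m)%N <= k < n (J + m).+1) h (J + m)%N)).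
  by apply: ler_sum_nat => k; apply: Gh; rewrite leq_addr.
by rewrite sumr_const_nat -[leLHS]mulr_natl ler_wpM2r// ler_nat leq_subr.
Qed.

Lemma sum_nat_vanish_le (G : nat -> R) l m n : (forall k, 0 <= G k) ->
  (forall k, (n <= k < m)%N -> G k = 0) -> \sum_(l <= k < m) G k <= \sum_(l <= k < n) G k.
Proof.
move=> G0 Gn; have [ml|/ltnW lm] := leqP m l; first by rewrite big_geq ?sumr_ge0.
have [mn|/ltnW nm] := leqP m n; first by rewrite [leRHS](big_cat_nat lm mn)/= lerDl sumr_ge0.
have [ln|/ltnW nl] := leqP l n.
  rewrite (big_cat_nat ln nm)/= [X in _ + X]big_nat_cond [X in _ + X]big1 ?addr0//.
  by move=> k /andP[/Gn].
rewrite big_nat_cond big1 ?sumr_ge0// => k /andP[/andP[lk km] _].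
by rewrite Gn// km (leq_trans nl).
Qed.

Lemma uniform_threshold (P : nat -> R -> Prop) n :
  (forall k, (k < n)%N -> exists2 t0 : R, 0 < t0 & forall t, 0 < t < t0 -> P k t) ->
  exists2 t0 : R, 0 < t0 & forall k t, (k < n)%N -> 0 < t < t0 -> P k t.
Proof.
elim: n => [|n IH] hP; first by exists 1.
have [t0 t00 ht0] := IH (fun k kn => hP k (ltnW kn)).
have [t1 t10 ht1] := hP n (leqnn _).
exists (Num.min t0 t1); first by rewrite lt_min t00.
move=> k t; rewrite ltnS leq_eqVlt lt_min => /predU1P[->|kn] /and3P[tgt tt0 tt1].
  by apply: ht1; rewrite tgt.
by apply: ht0 => //; rewrite tgt.
Qed.

(** Open on the left because [ratio_sup] requires [tau] strictly above [sigma ^+ 2]. *)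
Lemma dyadic_floor (y : R) : 1 < y -> exists j, 2 ^+ j < y <= 2 ^+ j.+1.
Proof.
move=> y1; have /ex_minnP[[|j] yj jmin] : exists j, y <= 2 ^+ j.
  exists (Num.bound y); have y0 : 0 <= y by rewrite ltW// (lt_trans ltr01).
  by rewrite ltW// bound_lt_pow2.
- by move: yj; rewrite expr0 leNgt y1.
- exists j; rewrite yj andbT ltNge; apply/negP => /jmin.
  by rewrite ltnn.
Qed.

End Tails.

(** * Termwise limit in one half of the hyperbola sum *)

Section Tannery.
Context {R : realType}.
Implicit Types (phi psi s : R -> R) (lam : R^nat).

Definition weight phi (q t : R) := phi t^-1 / t `^ q.

Lemma powR_inv (x r : R) : 0 < x -> x^-1 `^ r = (x `^ r)^-1.
Proof.
by move=> x0; rewrite -powR_inv1 ?ltW// -powRrM mulN1r powRN.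
Qed.

Lemma weight_gt0 phi q t : (forall tau, 0 < tau -> 0 < phi tau) -> 0 < t -> 0 < weight phi q t.
Proof. by move=> phi0 t0; rewrite divr_gt0 ?powR_gt0// phi0// invr_gt0. Qed.

Lemma weight_scale phi q t u : 0 < t -> 0 < u ->
  weight phi q (t / u) = phi (t^-1 * u) * u `^ q / t `^ q.
Proof.
move=> t0 u0; rewrite /weight invf_div powRM ?ltW ?invr_gt0// powR_inv//.
by rewrite invfM invrK [u / t]mulrC -!mulrA [_^-1 * _]mulrC.
Qed.

Definition asymptotic (N : R -> R) phi s q := forall e, 0 < e ->
  exists2 t0 : R, 0 < t0 & forall t, 0 < t < t0 ->
    `|N t - s (ln t^-1) * weight phi q t| <= e * (s (ln t^-1) * weight phi q t).

Context (q a b : R) (phi psi s : R -> R) (lam lam' : R^nat) (C' t' : R).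
Context (q0 : 0 < q) (a0 : 0 < a) (sab : forall tau, a <= s tau <= b).
Context (hphi : regular_slowly_varying phi) (hpsi : regular_slowly_varying psi).
Context (dlam' : nonincreasing_seq lam') (lam'_ge0 : forall n, 0 <= lam' n).
Context (lam'_to0 : forall r, 0 < r -> exists n, lam' n < r).
Context (asym : asymptotic (fun t => (count_above lam t)%:R) phi s q).
Context (C'0 : 0 < C') (t'0 : 0 < t').
Context (bound' : forall t, 0 < t < t' -> (count_above lam' t)%:R <= C' * weight psi q t).
Context (int_fin : (\int[lebesgue_measure]_(sigma in `[1%R, +oo[)
     ((psi sigma / sigma)%:E * ratio_sup phi sigma) < +oo)%E).

Local Notation c := (count_above lam).
Local Notation c' := (count_above lam').
Local Notation nn j := (c' (2 ^+ j)^-1).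
Local Notation w j := ((2 ^+ j) `^ q).

Let phi0 tau : 0 < tau -> 0 < phi tau. Proof. exact: regular_gt0. Qed.
Let psi0 tau : 0 < tau -> 0 < psi tau. Proof. exact: regular_gt0. Qed.
Let pow0 j : 0 < 2 ^+ j :> R. Proof. by rewrite exprn_gt0. Qed.
Let b0 : 0 < b.
Proof. by have /andP[aS Sb] := sab 0; rewrite (lt_le_trans a0)// (le_trans aS). Qed.
Let s0 tau : 0 < s tau. Proof. by have /andP[+ _] := sab tau; exact: lt_le_trans. Qed.

Lemma asymptotic_bound : exists C t0, [/\ 0 < C, 0 < t0 &
  forall t, 0 < t < t0 -> (c t)%:R <= C * weight phi q t].
Proof.
have [t0 t00 ht0] := asym ltr01; exists (2 * b), t0; split; rewrite ?mulr_gt0//.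
move=> t /[dup] /andP[tgt _] /ht0; rewrite mul1r ler_norml => /andP[_ ct].
have wt : 0 < weight phi q t by exact: weight_gt0.
have /andP[_ sb] := sab (ln t^-1).
have := ler_wpM2r (ltW wt) sb; lra.
Qed.

Lemma nn_mono : {homo (fun j => nn j) : i j / (i <= j)%N}.
Proof.
move=> i j ij; apply: count_above_mono; rewrite ?invr_gt0//.
  exact: vanishing_finite.
by move=> k; apply: le_lt_trans; rewrite lef_pV2 ?posrE// ler_eXn2l// ltr1n.
Qed.

Lemma nnP j k : (nn j <= k < nn j.+1)%N -> (2 ^+ j.+1)^-1 < lam' k <= (2 ^+ j)^-1.
Proof.
by rewrite leqNgt !(count_above_seq _ dlam')// ?invr_gt0// -leNgt andbC.
Qed.

(* [nn j] is the index of the first eigenvalue [lam' k <= 2^-j], so the indices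
   [nn j <= k < nn j.+1] form a dyadic block; [M j] stands for the finite value of
   [ratio_sup phi] at [2^j]. *)
Lemma dyadic_blocks : exists (M : nat -> R) (J0 : nat),
  [/\ forall j, (J0 <= j)%N -> 1 / 2 <= M j,
      forall j tau, (J0 <= j)%N -> (2 ^+ j) ^+ 2 < tau -> phi (tau / 2 ^+ j) <= M j * phi tau,
      forall e, 0 < e -> exists2 J, (J0 <= J)%N &
        forall j, (J <= j)%N -> psi (2 ^+ j) * M j <= e &
      forall e, 0 < e -> exists2 J, (J0 <= J)%N &
        forall J1 J' (G : nat -> R), (J <= J1)%N ->
        (forall j k, (J1 <= j)%N -> (nn j <= k < nn j.+1)%N -> G k <= M j / w j) ->
        \sum_(nn J1 <= k < nn J') G k <= e].
Proof.
have [M [j0 [B [M1 M2 M3]]]] := dyadic_majorant hphi hpsi int_fin.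
have [z0 z01 psi2] := regular_doubling hpsi.
have z0gt0 : 0 < z0 by rewrite (lt_le_trans ltr01).
pose J0 := maxn j0 (Num.bound (Num.max z0 t'^-1)).
have J0P j : (J0 <= j)%N -> z0 <= 2 ^+ j /\ (2 ^+ j)^-1 < t'.
  rewrite geq_max => /andP[_ jj]; suff : Num.max z0 t'^-1 < 2 ^+ j.
    by rewrite gt_max => /andP[/ltW z0j t'j]; rewrite invf_plt ?posrE.
  have yz0 : 0 <= Num.max z0 t'^-1 by rewrite le_max (ltW z0gt0).
  exact: bound_lt_pow2.
have J0j0 j : (J0 <= j)%N -> (j0 <= j)%N by rewrite geq_max => /andP[].
have Mgt0 j : (j0 <= j)%N -> 0 < M j by move=> /M1; apply: lt_le_trans; rewrite divr_gt0.
pose D j := psi (2 ^+ j) * M j.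
have D0 j : (j0 <= j)%N -> 0 <= D j by move=> jj; rewrite mulr_ge0 ?ltW ?psi0 ?Mgt0.
have w0 j : 0 < w j by rewrite powR_gt0.
(* [C'] comes from [bound'], [expR 1] from moving [psi] from [2 ^+ j.+1] to [2 ^+ j], and the last
   factor from the same move in the power. *)
pose K := C' * expR 1 * 2 `^ q.
have K0 : 0 < K by rewrite !mulr_gt0 ?expR_gt0 ?powR_gt0.
have nnK j : (J0 <= j)%N -> (nn j.+1)%:R <= K * (psi (2 ^+ j) * w j).
  move=> jj; have [zj _] := J0P _ jj; have [_ tj] := J0P _ (leqW jj).
  have := @bound' (2 ^+ j.+1)^-1; rewrite invr_gt0 pow0 tj => /(_ isT)/le_trans; apply.
  rewrite /weight invrK powR_inv// invrK exprS powRM ?ler0n ?(ltW (pow0 j))//.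
  have [|psij _] := psi2 (2 ^+ j) (2 * 2 ^+ j) zj.
    by rewrite lexx ler_peMl ?ler1n// ltW.
  rewrite /K -!mulrA ler_pM2l// !mulrA ler_wpM2r ?(ltW (w0 j))//.
  by rewrite mulrAC ler_wpM2r ?powR_ge0.
clearbody K.
exists M, J0; split=> [j /J0j0/M1//|j tau /J0j0/M2|e e0|e e0]; first exact.
  (* A single term is a tail sum of length one. *)
  have [J j0J hJ] := bounded_tail D0 M3 e0.
  exists (maxn J0 J); first by rewrite leq_maxl.
  by move=> j; rewrite geq_max => /andP[_ /(hJ _ j.+1)]; rewrite big_nat1.
have eK : 0 < e / K by rewrite divr_gt0.
have [J j0J hJ] := bounded_tail D0 M3 eK.
exists (maxn J0 J); first by rewrite leq_maxl.
move=> J1 J' G; rewrite geq_max => /andP[J0J1 JJ1] GM.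
have [J'J1|/ltnW J1J'] := leqP J' J1; first by rewrite big_geq ?nn_mono// ltW.
have h0 j : (J1 <= j)%N -> 0 <= M j / w j.
  by move=> jj; rewrite divr_ge0 ?ltW ?Mgt0// J0j0// (leq_trans J0J1).
rewrite (le_trans (block_sum_le (n := fun j => nn j) nn_mono J1J' GM h0))//.
(* The factor [w j] in the size of the block cancels the one in the majorant, leaving the summable
   [psi (2 ^+ j) * M j]. *)
apply: (@le_trans _ _ (\sum_(J1 <= j < J') K * D j)).
  apply: ler_sum_nat => j /andP[J1j _].
  have jj := leq_trans J0J1 J1j.
  rewrite (le_trans (ler_wpM2r (h0 _ J1j) (nnK _ jj)))//.
  rewrite /D -!mulrA ler_pM2l// ler_wpM2l ?(ltW (psi0 (pow0 j)))//.
  by rewrite [leLHS]mulrC divfK// gt_eqF.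
by rewrite -mulr_sumr mulrC -ler_pdivlMr// hJ.
Qed.

Lemma transform_term_le j k tau : (nn j <= k < nn j.+1)%N ->
  s (tau + ln (lam' k)) * lam' k `^ q <= b / w j.
Proof.
move=> /nnP/andP[jk kj]; have k0 : 0 < lam' k by rewrite (lt_trans _ jk)// invr_gt0.
have /andP[_ sb] := sab (tau + ln (lam' k)).
rewrite -powR_inv//; apply: ler_pM => //; rewrite ?(ltW (s0 _)) ?powR_ge0//.
by apply: ge0_ler_powR; rewrite ?nnegrE ?invr_ge0 ?(ltW q0) ?(ltW k0) ?(ltW (pow0 j)).
Qed.

(** One [J] serves for the series and for the hyperbola sum, uniformly in [tau], [t] and [m]: on
    block [j] the terms of both are at most a constant times [M j / w j]. *)
Lemma dyadic_tails e : 0 < e -> exists J,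
  (forall tau m, \sum_(nn J <= k < m | 0 < lam' k) s (tau + ln (lam' k)) * lam' k `^ q <= e) /\
  (forall t m, 0 < t -> (m <= c' (Num.sqrt t))%N ->
    \sum_(nn J <= k < m) (c (t / lam' k))%:R <= e * weight phi q t).
Proof.
move=> e0; have [M [J0 [M1 M2 _ Mtail]]] := dyadic_blocks.
have [C [t0 [C0 t00 cC]]] := asymptotic_bound.
have [y0 y01 phi2] := regular_doubling hphi.
have y0gt0 : 0 < y0 by rewrite (lt_le_trans ltr01).
(* [2 * b] handles the series through [M j >= 1 / 2]; [C * expR 1] handles the counts, with one
   doubling step for [phi]. *)
pose A := 2 * b + C * expR 1.
have A1 : 2 * b <= A by rewrite lerDl mulr_ge0 ?expR_ge0// ltW.
have A2 : C * expR 1 <= A by rewrite lerDr mulr_ge0// ltW.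
have A0 : 0 < A by rewrite (lt_le_trans _ A1)// mulr_gt0.
have [J1 J01 hJ1] := Mtail _ (divr_gt0 e0 A0).
pose J := maxn J1 (Num.bound (Num.max y0 t0^-1)).
have JP j : (J <= j)%N -> y0 <= 2 ^+ j /\ (2 ^+ j)^-1 < t0.
  rewrite geq_max => /andP[_ jj]; suff : Num.max y0 t0^-1 < 2 ^+ j.
    by rewrite gt_max => /andP[/ltW y0j t0j]; rewrite invf_plt ?posrE.
  have yz0 : 0 <= Num.max y0 t0^-1 by rewrite le_max (ltW y0gt0).
  exact: bound_lt_pow2.
have J0J j : (J <= j)%N -> (J0 <= j)%N.
  by rewrite geq_max => /andP[/(leq_trans J01)].
have J1J : (J1 <= J)%N by rewrite leq_maxl.
have w0 j : 0 < w j by rewrite powR_gt0.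
have Mgt0 j : (J <= j)%N -> 0 < M j by move=> /J0J/M1; apply: lt_le_trans; rewrite divr_gt0.
have tail_le (G : nat -> R) J' :
    (forall j k, (J <= j)%N -> (nn j <= k < nn j.+1)%N -> G k <= A * (M j / w j)) ->
    \sum_(nn J <= k < nn J') G k <= e.
  move=> GM; have := hJ1 J J' (fun k => G k / A) J1J.
  rewrite -mulr_suml ler_pM2r ?invr_gt0//; apply=> j k jj kj.
  by rewrite ler_pdivrMr// mulrC GM.
exists J; split=> [tau m|t m t0' mt].
  (* Finitely many positive [lam' k] lie in finitely many blocks; the zero ones lie in none and
     contribute nothing. *)
  have [J' mJ'] : exists J', forall k, (k < m)%N -> 0 < lam' k -> (k < nn J')%N.
    elim: m => [|m [J' mJ']]; first by exists 0%N.
    have [m0|] := ltP 0 (lam' m); last first.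
      move=> m0; exists J' => k; rewrite ltnS leq_eqVlt => /predU1P[->|/mJ'//].
      by rewrite ltNge m0.
    have [J'' J''m] := pow2_inv_lt m0.
    exists (maxn J' J'') => k; rewrite ltnS leq_eqVlt => /predU1P[-> _|km k0].
      apply: leq_trans (nn_mono (leq_maxr J' J'')).
      by rewrite (count_above_seq _ dlam')// invr_gt0.
    by apply: leq_trans (nn_mono (leq_maxl J' J'')); exact: mJ'.
  rewrite big_mkcond/=; set G := fun k : nat => _.
  apply: (le_trans (sum_nat_vanish_le (n := nn J') _ _ _)).
  - by move=> k; rewrite /G; case: ifP => // _; rewrite mulr_ge0 ?powR_ge0// ltW.
  - move=> k /andP[J'k km]; rewrite /G; case: ifPn => // k0.
    by have := mJ' _ km k0; rewrite ltnNge J'k.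
  apply: tail_le => j k jj kj; have /nnP/andP[jk _] := kj.
  rewrite /G ifT; last by rewrite (lt_trans _ jk)// invr_gt0.
  rewrite (le_trans (transform_term_le tau kj))// mulrA ler_wpM2r ?invr_ge0 ?powR_ge0//.
  have := ler_wpM2r (ltW (Mgt0 _ jj)) A1; have := ler_wpM2l (ltW b0) (M1 _ (J0J _ jj)).
  lra.
have wt0 : 0 < weight phi q t by exact: weight_gt0.
have st : 0 < Num.sqrt t by rewrite sqrtr_gt0.
have [J' J'm] : exists J', (m <= nn J')%N.
  have [J' J't] := pow2_inv_lt st.
  exists J'; rewrite (leq_trans mt)//; apply: count_above_mono; rewrite ?invr_gt0//.
    exact: vanishing_finite.
  by move=> k; apply: lt_trans.
pose G k : R := if (k < m)%N then (c (t / lam' k))%:R / weight phi q t else 0.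
have -> : \sum_(nn J <= k < m) (c (t / lam' k))%:R =
    (\sum_(nn J <= k < m) G k) * weight phi q t.
  rewrite mulr_suml; apply: eq_big_nat => k /andP[_ km].
  by rewrite /G km divfK// gt_eqF.
rewrite ler_wpM2r ?(ltW wt0)//.
apply: (le_trans (sum_nat_vanish_le (n := nn J') _ _ _)).
- by move=> k; rewrite /G; case: ifP => // _; rewrite divr_ge0// ltW.
- by move=> k /andP[J'k km]; have := leq_trans km J'm; rewrite ltnNge J'k.
apply: tail_le => j k jj kj; have /nnP/andP[jk kj'] := kj.
rewrite /G; case: ifPn => [km|_]; last first.
  by rewrite mulr_ge0 ?(ltW A0)// divr_ge0 ?powR_ge0// ltW// Mgt0.
have u0 : 0 < lam' k by rewrite (lt_trans _ jk)// invr_gt0.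
have su : Num.sqrt t < lam' k by rewrite -(count_above_seq _ dlam')// (leq_trans km).
(* The cut at [sqrt t] is used here: as [u] is at most [2 ^- j], it yields [(2 ^+ j) ^+ 2 < t^-1],
   the range where [M j] controls [phi]. *)
have tu : t < lam' k * lam' k.
  by rewrite -expr2 -(sqr_sqrtr (ltW t0')) ltr_sqr ?nnegrE ?sqrtr_ge0// ltW.
set u := lam' k in jk kj' u0 su tu *.
have [y0j t0j] := JP _ jj.
have tut0 : 0 < t / u < t0.
  rewrite divr_gt0//= ltr_pdivrMr// (lt_le_trans tu)// ler_wpM2r ?(ltW u0)//.
  by rewrite (le_trans kj') ?ltW.
rewrite ler_pdivrMr// (le_trans (cC _ tut0))// weight_scale//.
have ti0 : 0 < t^-1 by rewrite invr_gt0.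
have uj : 2 ^+ j <= u^-1 by rewrite -[2 ^+ j]invrK lef_pV2 ?posrE ?invr_gt0.
have tiu : u^-1 * u^-1 < t^-1 by rewrite -invfM ltf_pV2 ?posrE ?mulr_gt0.
have uyt : y0 <= t^-1 * u.
  rewrite (le_trans y0j)// (le_trans uj)// ltW// -ltr_pdivrMr//.
have [|_] := phi2 _ (t^-1 / 2 ^+ j) uyt.
  rewrite ler_pM2l// kj'/= mulrCA ler_pM2l//.
  by have := ltW jk; rewrite exprS invfM ler_pdivrMl.
have : phi (t^-1 / 2 ^+ j) <= M j * phi t^-1.
  apply: M2; first exact: J0J.
  apply: le_lt_trans tiu; rewrite expr2; apply: ler_pM => //; exact: ltW.
set ph := phi (t^-1 / _); set ph' := phi (t^-1 * u) => phM phe.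
have uq : u `^ q <= (w j)^-1.
  rewrite -powR_inv//.
  by apply: ge0_ler_powR; rewrite ?nnegrE ?invr_ge0 ?(ltW q0) ?(ltW u0) ?(ltW (pow0 j)).
rewrite /weight.
have tq : 0 < t `^ q by rewrite powR_gt0.
rewrite !mulrA ler_wpM2r ?invr_ge0 ?(ltW tq)//.
apply: (@le_trans _ _ (C * (expR 1 * (M j * phi t^-1)) * (w j)^-1)).
  apply: ler_pM; rewrite ?powR_ge0 ?mulr_ge0 ?(ltW C0)//.
    by rewrite ltW// phi0// mulr_gt0.
  rewrite ler_wpM2l ?(ltW C0)// (le_trans phe)// ler_wpM2l ?expR_ge0//.
rewrite -!mulrA [phi _ * _]mulrC !mulrA !ler_wpM2r ?invr_ge0 ?powR_ge0 ?(ltW (Mgt0 _ jj))//.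
by rewrite ltW// phi0.
Qed.

Lemma term_limit u e : 0 < u -> 0 < e -> exists2 t0 : R, 0 < t0 & forall t, 0 < t < t0 ->
  `|(c (t / u))%:R - s (ln t^-1 + ln u) * u `^ q * weight phi q t| <= e * weight phi q t.
Proof.
move=> u0 e0; have uq0 : 0 < u `^ q by rewrite powR_gt0.
(* The asymptotics at [t / u] cost at most [2 * eta * X], since [rho <= 2], and replacing [rho] by 1
   costs [eta * X], whence the 3. *)
pose eta := Num.min 1 (e / (3 * (b * u `^ q))).
have buq : 0 < 3 * (b * u `^ q) by rewrite !mulr_gt0.
have eta0 : 0 < eta by rewrite lt_min ltr01 divr_gt0.
have eta1 : eta <= 1 by rewrite ge_min lexx.
have etae : 3 * eta * (b * u `^ q) <= e.
  by rewrite mulrAC -ler_pdivlMl// mulrC ge_min lexx orbT.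
have [t1 t10 ht1] := asym eta0.
have [_ _ /(_ u u0) phi_sv] : slowly_varying phi by case: hphi.
have [B [_ hB]] := (cvgrPdist_le _ _).1 phi_sv _ eta0.
pose t2 := (Num.max 1 B + 1)^-1.
have B1 : 0 < Num.max 1 B + 1 by rewrite ltr_wpDl// le_max ler01.
have t20 : 0 < t2 by rewrite invr_gt0.
exists (Num.min (t1 * u) t2); first by rewrite lt_min mulr_gt0.
move=> t /andP[t0]; rewrite lt_min => /andP[tt1 tt2].
have ti0 : 0 < t^-1 by rewrite invr_gt0.
have Bt : B < t^-1.
  rewrite (@le_lt_trans _ _ (Num.max 1 B))// ?le_max ?lexx ?orbT//.
  by rewrite (@lt_trans _ _ (Num.max 1 B + 1))// ?ltrDl// -[ltLHS]invrK ltf_pV2 ?posrE.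
have wt0 : 0 < weight phi q t by exact: weight_gt0.
have := ht1 (t / u); rewrite divr_gt0//= ltr_pdivrMr// => /(_ tt1).
rewrite weight_scale// invf_div lnM ?posrE// [ln u + _]addrC.
have := hB _ Bt; rewrite [u * _]mulrC.
have phit : 0 < phi t^-1 by exact: phi0.
set rho := phi (t^-1 * u) / phi t^-1 => hrho.
have -> : phi (t^-1 * u) * u `^ q / t `^ q = rho * (u `^ q * weight phi q t).
  by rewrite /rho /weight; field; rewrite !gt_eqF ?powR_gt0.
set S := s _; have S0 : 0 < S by exact: s0.
have Sb : S <= b by have /andP[] := sab (ln t^-1 + ln u).
rewrite -[S * u `^ q * _]mulrA [S * (rho * _)]mulrCA; set X := S * (u `^ q * _).
have X0 : 0 <= X by apply: mulr_ge0; [exact: ltW|apply: mulr_ge0; exact: ltW].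
have Xb : 3 * eta * X <= e * weight phi q t.
  apply: (@le_trans _ _ (3 * eta * (b * u `^ q) * weight phi q t)); last first.
    by rewrite ler_wpM2r// ltW.
  rewrite -[3 * eta * _ * _]mulrA ler_wpM2l ?mulr_ge0 ?(ltW eta0)//.
  by rewrite /X mulrA !ler_wpM2r ?(ltW wt0) ?(ltW uq0).
move: hrho; rewrite ler_distlC => /andP[rho1 rho2].
rewrite !ler_distl => /andP[c1 c2].
have hX1 : rho * X <= (1 + eta) * X by rewrite ler_wpM2r.
have hX2 : (1 - eta) * X <= rho * X by rewrite ler_wpM2r.
have hX3 : eta * (rho * X) <= 2 * eta * X.
  rewrite -[2 * eta * X]mulrA [2 * _]mulrCA ler_wpM2l ?(ltW eta0)// (le_trans hX1)//.
  by rewrite ler_wpM2r// lerD2l.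
apply/andP; split; move: hX1 hX2 hX3 Xb c1 c2; lra.
Qed.

Lemma nnJ_pos J k : (k < nn J)%N -> 0 < lam' k.
Proof.
rewrite (count_above_seq _ dlam')// ?invr_gt0//; apply: lt_trans.
by rewrite invr_gt0.
Qed.

(** All [lam' k] with [k < nn J] are positive, so the head needs no condition; the later partial
    sums are increasing and at most [e] above it, which yields convergence together with the
    error. *)
Lemma transform_approx p e J tau : q = p^-1 ->
  (forall m, \sum_(nn J <= k < m | 0 < lam' k) s (tau + ln (lam' k)) * lam' k `^ q <= e) ->
  \sum_(0 <= k < nn J) s (tau + ln (lam' k)) * lam' k `^ q <=
  periodic_transform p s lam' tau <=
  \sum_(0 <= k < nn J) s (tau + ln (lam' k)) * lam' k `^ q + e.
Proof.
move=> qp tail; rewrite /periodic_transform -qp.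
pose f k := s (tau + ln (lam' k)) * lam' k `^ q.
pose S m := \sum_(0 <= k < m | 0 < lam' k) f k.
have f0 k : 0 <= f k by rewrite mulr_ge0 ?powR_ge0// ltW.
have SJ : S (nn J) = \sum_(0 <= k < nn J) f k.
  rewrite /S big_nat_cond [RHS]big_nat_cond; apply: eq_bigl => k.
  by rewrite andbT; case: ltnP => //= /nnJ_pos ->.
have S_ge m : (nn J <= m)%N -> S (nn J) <= S m <= S (nn J) + e.
  move=> Jm; rewrite {2 3}/S (big_cat_nat (leq0n _) Jm)/= lerDl lerD2l tail andbT.
  exact: sumr_ge0.
have ndS : nondecreasing_seq S.
  apply/nondecreasing_seqP => n; rewrite /S [leRHS]big_mkcond [leLHS]big_mkcond big_nat_recr//=.
  by rewrite lerDl; case: ifP.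
have cvS : cvgn S.
  apply: nondecreasing_is_cvgn => //; exists (S (nn J) + e) => _ [m _ <-].
  have [mJ|/ltnW Jm] := leqP m (nn J); last by have /andP[] := S_ge _ Jm.
  have /andP[h1 h2] := S_ge _ (leqnn _).
  by rewrite (le_trans (ndS _ _ mJ)).
rewrite -!/(f _) -SJ; apply/andP; split.
  apply: limr_ge => //; exists (nn J) => // m /= Jm.
  by have /andP[] := S_ge _ Jm.
apply: limr_le => //; exists (nn J) => // m /= Jm.
by have /andP[] := S_ge _ Jm.
Qed.

(** The operator counted enters through its asymptotics, the one summed over through an upper bound
    of its counting function; the result is applied twice with the roles exchanged. The error is
    split into three thirds: the head, the tail of the counts and the tail of the series. *)
Lemma tannery p e : q = p^-1 -> 0 < e -> exists2 t0 : R, 0 < t0 & forall t, 0 < t < t0 ->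
  `|\sum_(k < c' (Num.sqrt t)) (c (t / lam' k))%:R
    - periodic_transform p s lam' (ln t^-1) * weight phi q t| <= e * weight phi q t.
Proof.
move=> qp e0; have e3 : 0 < e / 3 by rewrite divr_gt0.
have [J [tail1 tail2]] := dyadic_tails e3.
have e3n : 0 < e / 3 / (nn J).+1%:R by rewrite divr_gt0.
have [|t0 t00 ht0] := @uniform_threshold R (fun k t =>
    `|(c (t / lam' k))%:R - s (ln t^-1 + ln (lam' k)) * lam' k `^ q * weight phi q t| <=
    e / 3 / (nn J).+1%:R * weight phi q t) (nn J).
  by move=> k /nnJ_pos k0; exact: term_limit.
(* The second bound gives [sqrt t < 2 ^- J], so that the whole head lies in the range of
   summation. *)
exists (Num.min t0 ((2 ^+ J)^-1 ^+ 2)); first by rewrite lt_min t00 exprn_gt0// invr_gt0.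
move=> t /andP[tgt]; rewrite lt_min => /andP[tt0 tJ].
have wt0 : 0 < weight phi q t by exact: weight_gt0.
have sJ : Num.sqrt t < (2 ^+ J)^-1.
  by rewrite -ltr_sqr ?nnegrE ?sqrtr_ge0 ?invr_ge0 ?(ltW (pow0 J))// sqr_sqrtr// ltW.
have Jc : (nn J <= c' (Num.sqrt t))%N.
  apply: count_above_mono; rewrite ?invr_gt0 ?sqrtr_gt0//; first exact: vanishing_finite.
  by move=> k; apply: lt_trans.
rewrite -(big_mkord xpredT (fun k => (c (t / lam' k))%:R)) (big_cat_nat (leq0n _) Jc)/=.
pose S1 : R := \sum_(0 <= k < nn J) (c (t / lam' k))%:R.
pose S2 : R := \sum_(nn J <= k < c' (Num.sqrt t)) (c (t / lam' k))%:R.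
pose S1' := \sum_(0 <= k < nn J) s (ln t^-1 + ln (lam' k)) * lam' k `^ q.
rewrite -/S1 -/S2.
have h2 : S2 <= e / 3 * weight phi q t by exact: tail2.
have S20 : 0 <= S2 by rewrite sumr_ge0.
have := transform_approx qp (tail1 (ln t^-1)); rewrite -/S1' => /andP[].
set P := periodic_transform _ _ _ _ => P1 P2.
have h1 : `|S1 - S1' * weight phi q t| <= e / 3 * weight phi q t.
  rewrite /S1 /S1' mulr_suml -sumrB (le_trans (ler_norm_sum _ _ _))//.
  apply: (@le_trans _ _ (\sum_(0 <= k < nn J) e / 3 / (nn J).+1%:R * weight phi q t)).
    by apply: ler_sum_nat => k /andP[_ kJ]; apply: ht0 => //; rewrite tgt.
  rewrite sumr_const_nat subn0 -[leLHS]mulr_natr [leLHS]mulrAC ler_wpM2r ?(ltW wt0)//.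
  rewrite -[leRHS]mulr1 -[e / 3 / _ * _]mulrA ler_wpM2l ?(ltW e3)//.
  by rewrite mulrC ler_pdivrMr// mul1r ler_nat.
have P1' := ler_wpM2r (ltW wt0) P1; have P2' := ler_wpM2r (ltW wt0) P2.
move: h1 P2' ; rewrite !ler_distl mulrDl => /andP[h11 h12] P2'.
apply/andP; split; lra.
Qed.

Lemma cross_term e : 0 < e -> exists2 t0 : R, 0 < t0 & forall t, 0 < t < t0 ->
  (c (Num.sqrt t))%:R * (c' (Num.sqrt t))%:R <= e * weight phi q t.
Proof.
move=> e0; have [M [J0 [M1 M2 Msmall _]]] := dyadic_blocks.
have [C [t0 [C0 t00 cC]]] := asymptotic_bound.
have [y0 y01 phi2] := regular_doubling hphi.
have [z0 z01 psi2] := regular_doubling hpsi.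
pose A := C * C' * expR 1 ^+ 2.
have e1 : 0 < expR 1 :> R by rewrite expR_gt0.
have A0 : 0 < A by rewrite !mulr_gt0 ?exprn_gt0.
have [J J0J hJ] := Msmall _ (divr_gt0 e0 A0).
(* Once [y > B], the point [1 / y] is below both thresholds, [y] and [2 ^+ j] are in the doubling
   ranges (the factors 2 pay for [2 ^+ j >= y / 2]), and [j >= J]. *)
pose B := Num.max (Num.max t0^-1 t'^-1) (Num.max (Num.max (2 * y0) (2 * z0)) (2 ^+ J.+1)).
have BJ : 2 ^+ J.+1 <= B by rewrite !le_max lexx !orbT.
have By : 2 * y0 <= B by rewrite !le_max lexx !orbT.
have Bz : 2 * z0 <= B by rewrite !le_max lexx !orbT.
have Bt0 : t0^-1 <= B by rewrite !le_max lexx.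
have Bt' : t'^-1 <= B by rewrite !le_max lexx !orbT.
have B0 : 0 < B by rewrite (lt_le_trans (pow0 J.+1)).
have AE : A = C * C' * expR 1 ^+ 2 by [].
clearbody B A.
exists (B^-1 ^+ 2); first by rewrite exprn_gt0// invr_gt0.
move=> t /andP[tgt tB].
have r0 : 0 < Num.sqrt t by rewrite sqrtr_gt0.
have tr : t = Num.sqrt t * Num.sqrt t by rewrite -expr2 sqr_sqrtr// ltW.
set r := Num.sqrt t in r0 tr *.
have rB : B < r^-1.
  rewrite -[B]invrK ltf_pV2 ?posrE ?invr_gt0//.
  by rewrite -ltr_sqr ?nnegrE ?invr_ge0 ?(ltW B0) ?(ltW r0)// expr2 -tr.
have rt0 : 0 < r < t0.
  by rewrite r0 -[ltLHS]invrK invf_plt ?posrE ?invr_gt0// (le_lt_trans Bt0).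
have rt' : 0 < r < t'.
  by rewrite r0 -[ltLHS]invrK invf_plt ?posrE ?invr_gt0// (le_lt_trans Bt').
pose y := r^-1; have y_gt0 : 0 < y by rewrite invr_gt0.
have [j /andP[jy yj]] : exists j, 2 ^+ j < y <= 2 ^+ j.+1.
  apply: dyadic_floor; rewrite (lt_trans _ rB)// (lt_le_trans _ BJ)//.
  by rewrite exprn_egt1// ltr1n.
have Jj : (J <= j)%N.
  have : 2 ^+ J.+1 < 2 ^+ j.+1 :> R by rewrite (le_lt_trans BJ)// (lt_le_trans rB).
  by rewrite ltr_eXn2l ?ltr1n// ltnS => /ltnW.
have tyy : t^-1 = y * y by rewrite tr invfM.
have phiy : phi y <= expR 1 * (M j * phi t^-1).
  have [||_] := phi2 y (t^-1 / 2 ^+ j).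
  - have y2 : y0 <= 2 * y0 by rewrite ler_peMl ?ler1n// (le_trans ler01).
    by rewrite (le_trans y2)// (le_trans By)// ltW.
  - rewrite tyy ler_pdivlMr// ler_pM2l// (ltW jy)/= ler_pdivrMr// mulrAC ler_pM2r//.
    by rewrite -exprS.
  move/le_trans; apply; rewrite ler_pM2l//; apply: M2; first exact: leq_trans Jj.
  by rewrite tyy -expr2 ltr_sqr ?nnegrE// ltW.
have zj : z0 <= 2 ^+ j.
  have : 2 * z0 <= 2 * 2 ^+ j by rewrite -exprS (le_trans (le_trans Bz (ltW rB))).
  by rewrite ler_pM2l.
have psiy : psi y <= expR 1 * psi (2 ^+ j).
  by have [|] := psi2 (2 ^+ j) y zj; rewrite ?(ltW jy)//= -exprS.
have := cC _ rt0; have := bound' rt'; rewrite /weight -/y.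
have -> : t `^ q = r `^ q * r `^ q by rewrite {1}tr powRM// ltW.
have rq0 : 0 < r `^ q by rewrite powR_gt0.
move=> h1 h2; apply: (le_trans (ler_pM _ _ h2 h1)) => //.
have -> : C * (phi y / r `^ q) * (C' * (psi y / r `^ q)) =
    C * C' * (phi y * psi y) / (r `^ q * r `^ q) by field; rewrite gt_eqF.
rewrite [leRHS]mulrA ler_wpM2r ?invr_ge0 ?mulr_ge0 ?powR_ge0//.
have y0' := ltW (phi0 y_gt0); have z0' := ltW (psi0 y_gt0).
rewrite (le_trans (ler_wpM2l _ (ler_pM y0' z0' phiy psiy))) ?mulr_ge0 ?(ltW C0) ?(ltW C'0)//.
have -> : C * C' * (expR 1 * (M j * phi t^-1) * (expR 1 * psi (2 ^+ j))) =
    A * (psi (2 ^+ j) * M j) * phi t^-1 by rewrite AE; ring.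
rewrite ler_wpM2r ?(ltW (phi0 _)) ?invr_gt0// mulrC -ler_pdivlMr//.
exact: hJ.
Qed.

Lemma transform_gt0 p : q = p^-1 -> 0 < lam' 0%N ->
  exists2 d : R, 0 < d & forall tau, d <= periodic_transform p s lam' tau.
Proof.
move=> qp l0; have [J [tail1 _]] := dyadic_tails ltr01.
have [J' J'J] := pow2_inv_lt l0.
(* [J] keeps the tail bounded, and [J'] places the index 0 in the head. *)
pose L := maxn J J'.
have nL : (0 < nn L)%N.
  apply: leq_trans (nn_mono (leq_maxr J J')).
  by rewrite (count_above_seq _ dlam')// invr_gt0.
exists (a * lam' 0%N `^ q); first by rewrite mulr_gt0 ?powR_gt0.
have f0 tau k : 0 <= s (tau + ln (lam' k)) * lam' k `^ q.
  by rewrite mulr_ge0 ?powR_ge0// ltW.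
move=> tau; have [|lower _] := andP (@transform_approx p 1 L tau qp _).
  move=> m; have [mL|/ltnW Lm] := leqP m (nn L); first by rewrite big_geq.
  apply: le_trans (tail1 tau m).
  by rewrite [leRHS](big_cat_nat (nn_mono (leq_maxl J J')) Lm)/= lerDr sumr_ge0.
rewrite (le_trans _ lower)// big_ltn// -[leLHS]addr0 lerD ?sumr_ge0//.
by rewrite ler_wpM2r ?powR_ge0//; have /andP[] := sab (tau + ln (lam' 0%N)).
Qed.

End Tannery.

(** * From the estimates to the asymptotic equivalence *)

Section Equivalence.
Context {R : realType}.

Lemma near_right0P (P : R -> Prop) : (\forall t \near 0^'+, P t) <->
  exists2 t0 : R, 0 < t0 & forall t, 0 < t < t0 -> P t.
Proof.
split=> [[t0 /= t00 hP]|[t0 t00 hP]].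
  exists t0 => // t /andP[tgt tt0]; apply: hP => //=.
  by rewrite sub0r normrN gtr0_norm.
near=> t; apply: hP; apply/andP; split; near: t.
  exact: nbhs_right_gt.
exact: nbhs_right_lt.
Unshelve. all: by end_near. Qed.

Lemma equivalent_asymptotic (N phi s : R -> R) (q : R) :
  (forall tau, 0 < s tau) -> (forall tau, 0 < tau -> 0 < phi tau) ->
  N ~_(0^'+) (fun t : R => (phi t^-1 * s (ln t^-1) / t `^ q)%R) -> asymptotic N phi s q.
Proof.
move=> s0 phi0 /eqaddoP Nphi e e0; have /near_right0P[t0 t00 ht0] := Nphi e e0.
exists t0 => // t tt0; have /andP[tgt _] := tt0; have := ht0 t tt0.
rewrite !fctE; have wt := weight_gt0 q phi0 tgt.
have -> : phi t^-1 * s (ln t^-1) / t `^ q = s (ln t^-1) * weight phi q t.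
  by rewrite /weight mulrA [phi _ * _]mulrC.
by rewrite (gtr0_norm (mulr_gt0 (s0 _) wt)).
Qed.

(** A relative error below 1 against a positive main term makes the count positive for small [t], so
    the largest eigenvalue is positive. *)
Lemma asymptotic_count_gt0 (lam : R^nat) (phi s : R -> R) (q : R) : nonincreasing_seq lam ->
  (forall r : R, 0 < r -> exists n, lam n < r) ->
  (forall tau, 0 < s tau) -> (forall tau, 0 < tau -> 0 < phi tau) ->
  asymptotic (fun t => (count_above lam t)%:R) phi s q -> 0 < lam 0%N.
Proof.
move=> dlam lam_to0 s0 phi0 /(_ (1 / 2) (divr_gt0 ltr01 (ltr0Sn _ 1)))[t0 t00 ht0].
have t20 : 0 < t0 / 2 < t0 by rewrite divr_gt0//= ltr_pdivrMr// ltr_pMr// ltr1n.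
have /andP[t2 _] := t20; have := ht0 _ t20; have wt := weight_gt0 q phi0 t2.
have F0 : 0 < s (ln (t0 / 2)^-1) * weight phi q (t0 / 2) by rewrite mulr_gt0.
rewrite ler_norml => /andP[h _].
suff : (0 < count_above lam (t0 / 2))%N.
  by rewrite (count_above_seq _ dlam)//; apply: lt_trans.
rewrite -(ltr_nat R); move: h F0; lra.
Qed.

Lemma asymptotic_product (q p a b a' b' : R) (phi psi s s' : R -> R) (lam lam' : R^nat) :
  q = p^-1 -> 0 < q ->
  0 < a -> (forall tau, a <= s tau <= b) -> 0 < a' -> (forall tau, a' <= s' tau <= b') ->
  regular_slowly_varying phi -> regular_slowly_varying psi ->
  nonincreasing_seq lam -> (forall n, 0 <= lam n) ->
  (forall r, 0 < r -> exists n, lam n < r) ->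
  nonincreasing_seq lam' -> (forall n, 0 <= lam' n) ->
  (forall r, 0 < r -> exists n, lam' n < r) ->
  asymptotic (fun t => (count_above lam t)%:R) phi s q ->
  asymptotic (fun t => (count_above lam' t)%:R) psi s' q ->
  (\int[lebesgue_measure]_(sigma in `[1%R, +oo[)
     ((phi sigma / sigma)%:E * ratio_sup psi sigma) < +oo)%E ->
  (\int[lebesgue_measure]_(sigma in `[1%R, +oo[)
     ((psi sigma / sigma)%:E * ratio_sup phi sigma) < +oo)%E ->
  (fun t : R => (count_above (fun nk => lam nk.1 * lam' nk.2)%R t)%:R) ~_(0^'+)
  (fun t : R => ((phi t^-1 * periodic_transform p s lam' (ln t^-1) +
                  psi t^-1 * periodic_transform p s' lam (ln t^-1)) / t `^ q)%R).
Proof.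
move=> qp q0 a0 sab a'0 s'ab hphi hpsi dlam lam0 lam_to0 dlam' lam'0 lam'_to0 asy asy' int1 int2.
have s0 tau : 0 < s tau by have /andP[+ _] := sab tau; exact: lt_le_trans.
have s'0 tau : 0 < s' tau by have /andP[+ _] := s'ab tau; exact: lt_le_trans.
have phi0 tau : 0 < tau -> 0 < phi tau := regular_gt0 (tau := tau) hphi.
have psi0 tau : 0 < tau -> 0 < psi tau := regular_gt0 (tau := tau) hpsi.
have l0 := asymptotic_count_gt0 dlam lam_to0 s0 phi0 asy.
have l'0 := asymptotic_count_gt0 dlam' lam'_to0 s'0 psi0 asy'.
have [C [t1 [C0 t10 hC]]] := asymptotic_bound a0 sab hphi asy.
have [C' [t1' [C'0 t1'0 hC']]] := asymptotic_bound a'0 s'ab hpsi asy'.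
pose P := periodic_transform p s lam'; pose P' := periodic_transform p s' lam.
have [d d0 Pd] : exists2 d : R, 0 < d & forall tau, d <= P tau.
  exact: (transform_gt0 q0 a0 sab hphi hpsi dlam' lam'0 lam'_to0 asy C'0 t1'0 hC' int2 qp l'0).
have [d' d'0 P'd'] : exists2 d : R, 0 < d & forall tau, d <= P' tau.
  exact: (transform_gt0 q0 a'0 s'ab hpsi hphi dlam lam0 lam_to0 asy' C0 t10 hC int1 qp l0).
apply/eqaddoP => e e0.
(* The weight of [phi] collects two errors, from its half and from the cross term, and that of [psi]
   one; [d] and [d'] compare the weights with the main terms. *)
pose e1 := e * Num.min d d' / 2.
have e10 : 0 < e1 by rewrite divr_gt0// mulr_gt0// lt_min d0.
have e1d : 2 * e1 <= e * d.
  by rewrite /e1 mulrC divfK// ler_pM2l// ge_min lexx.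
have e1d' : 2 * e1 <= e * d'.
  by rewrite /e1 mulrC divfK// ler_pM2l// ge_min lexx orbT.
clearbody e1.
have [u1 u10 h1] := tannery q0 a0 sab hphi hpsi dlam' lam'0 lam'_to0 asy C'0 t1'0 hC' int2 qp e10.
have [u2 u20 h2] := tannery q0 a'0 s'ab hpsi hphi dlam lam0 lam_to0 asy' C0 t10 hC int1 qp e10.
have [u3 u30 h3] := cross_term a0 sab hphi hpsi dlam' lam'_to0 asy C'0 t1'0 hC' int2 e10.
apply/near_right0P; exists (Num.min u1 (Num.min u2 u3)); first by rewrite !lt_min u10 u20.
move=> t /andP[t0]; rewrite !lt_min => /and3P[tu1 tu2 tu3].
have {}h1 := h1 t (ltac:(by rewrite t0)); have {}h2 := h2 t (ltac:(by rewrite t0)).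
have {}h3 := h3 t (ltac:(by rewrite t0)).
have r0 : 0 < Num.sqrt t by rewrite sqrtr_gt0.
have := hyperbola_identity dlam dlam' lam0 lam'0 lam_to0 lam'_to0 r0.
rewrite sqr_sqrtr ?(ltW t0)// => /(congr1 (fun n => n%:R : R)).
rewrite !natrD natrM !natr_sum => hyp.
have wt := weight_gt0 q phi0 t0; have wt' := weight_gt0 q psi0 t0.
have FE : (phi t^-1 * P (ln t^-1) + psi t^-1 * P' (ln t^-1)) / t `^ q =
  P (ln t^-1) * weight phi q t + P' (ln t^-1) * weight psi q t.
  by rewrite /weight; ring.
rewrite !fctE -/P -/P' FE.
have F0 : 0 < P (ln t^-1) * weight phi q t + P' (ln t^-1) * weight psi q t.
  by rewrite addr_gt0// mulr_gt0//; [exact: lt_le_trans d0 _|exact: lt_le_trans d'0 _].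
rewrite (gtr0_norm F0).
have k1 : 2 * e1 * weight phi q t <= e * (P (ln t^-1) * weight phi q t).
  rewrite [leRHS]mulrA ler_wpM2r ?(ltW wt)// (le_trans e1d)// ler_wpM2l ?(ltW e0)//.
have k2 : 2 * e1 * weight psi q t <= e * (P' (ln t^-1) * weight psi q t).
  rewrite [leRHS]mulrA ler_wpM2r ?(ltW wt')// (le_trans e1d')// ler_wpM2l ?(ltW e0)//.
have cc0 : 0 <= (count_above lam (Num.sqrt t))%:R * (count_above lam' (Num.sqrt t))%:R :> R.
  by rewrite mulr_ge0.
have w1 := mulr_gt0 e10 wt; have w2 := mulr_gt0 e10 wt'.
move: h1 h2 h3 hyp; rewrite !ler_distl -/P -/P' => /andP[h11 h12] /andP[h21 h22] h3 hyp.
apply/andP; split; move: k1 k2 cc0 w1 w2 h11 h12 h21 h22 h3 hyp; lra.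
Qed.

End Equivalence.

Unset Implicit Arguments.

Theorem theorem7 (R : realType) (K : numFieldType) (ofR : R -> K) (conj : K -> K)
  (hK : scalar_field ofR conj)
  (H H' HH : hilbertSpace conj)
  (tens : {bilinear H -> H' -> HH}) (htens : hilbert_tensor tens)
  (T : {linear H -> H}) (T' : {linear H' -> H'}) (TT : {linear HH -> HH})
  (cT : compact_operator T) (saT : selfadjoint T) (nnT : nonnegative_operator T)
  (cT' : compact_operator T') (saT' : selfadjoint T')
  (nnT' : nonnegative_operator T')
  (hTT : tensor_operator tens T T' TT)
  (p : R) (hp : 0 < p)
  (phi phi' : R -> R)
  (hphi : regular_slowly_varying phi) (hphi' : regular_slowly_varying phi')
  (per per' : R) (s s' : R -> R)
  (hs : regular_periodic p per s) (hs' : regular_periodic p per' s')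
  (asymT : (fun t : R => counting_function ofR t T) ~_(0^'+)
           (fun t : R => (phi t^-1 * s (ln t^-1) / t `^ p^-1)%R))
  (asymT' : (fun t : R => counting_function ofR t T') ~_(0^'+)
            (fun t : R => (phi' t^-1 * s' (ln t^-1) / t `^ p^-1)%R))
  (int_phi : (\int[lebesgue_measure]_(tau in `[1%R, +oo[)
                (phi tau / tau)%:E < +oo)%E)
  (int_phi' : (\int[lebesgue_measure]_(tau in `[1%R, +oo[)
                 (phi' tau / tau)%:E < +oo)%E)
  (int_phi_m : (\int[lebesgue_measure]_(sigma in `[1%R, +oo[)
                  ((phi sigma / sigma)%:E * ratio_sup phi' sigma) < +oo)%E)
  (int_phi'_m : (\int[lebesgue_measure]_(sigma in `[1%R, +oo[)
                   ((phi' sigma / sigma)%:E * ratio_sup phi sigma) < +oo)%E) :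
  let s_star := periodic_transform p s (eigenvalues ofR T') in
  let s_star' := periodic_transform p s' (eigenvalues ofR T) in
  (fun t : R => counting_function ofR t TT) ~_(0^'+)
  (fun t : R => ((phi t^-1 * s_star (ln t^-1) + phi' t^-1 * s_star' (ln t^-1))
                 / t `^ p^-1)%R).
Proof.
have [lam [e De]] := diagonalizes_exists hK cT saT nnT.
have [lam' [e' De']] := diagonalizes_exists hK cT' saT' nnT'.
have [[dlam lam0] _ _ _ lam_to0] := De; have [[dlam' lam'0] _ _ _ lam'_to0] := De'.
have eigT := eigenvaluesE (diagonalizes_eigenvalue_sequence hK De saT).
have eigT' := eigenvaluesE (diagonalizes_eigenvalue_sequence hK De' saT').
have [_ _ [a [b [a0 sab]]] _] := hs; have [_ _ [a' [b' [a'0 s'ab]]] _] := hs'.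
have s0 tau : 0 < s tau by have /andP[+ _] := sab tau; exact: lt_le_trans.
have s'0 tau : 0 < s' tau by have /andP[+ _] := s'ab tau; exact: lt_le_trans.
have phi0 tau : 0 < tau -> 0 < phi tau := regular_gt0 (tau := tau) hphi.
have phi'0 tau : 0 < tau -> 0 < phi' tau := regular_gt0 (tau := tau) hphi'.
have countT : (fun t => counting_function ofR t T) = (fun t => (count_above lam t)%:R).
  by apply/funext => t; exact: counting_functionE De.
have countT' : (fun t => counting_function ofR t T') = (fun t => (count_above lam' t)%:R).
  by apply/funext => t; exact: counting_functionE De'.
rewrite countT in asymT; rewrite countT' in asymT'.
have asy := equivalent_asymptotic s0 phi0 asymT.
have asy' := equivalent_asymptotic s'0 phi'0 asymT'.
have q0 : 0 < p^-1 by rewrite invr_gt0.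
rewrite /= eigT eigT'.
have /eqaddoP main := asymptotic_product erefl q0 a0 sab a'0 s'ab hphi hphi' dlam lam0 lam_to0
  dlam' lam'0 lam'_to0 asy asy' int_phi_m int_phi'_m.
(* The counting function of [TT] is identified only at positive [t], so the transfer is made on a
   right neighbourhood of 0 and not by an equality of functions. *)
apply/eqaddoP => eps /main /near_right0P[t0 t00 ht0]; apply/near_right0P; exists t0 => // t tt0.
have := ht0 t tt0; rewrite !fctE (counting_function_tensor hK htens saT saT' hTT De De')//.
by case/andP: tt0.
Qed.
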